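(* There is a deterministic polynomial-time algorithm that, given an $n$-vertex graph $G=(V,E)$, an integer $f\ge 1$, an $f$-respecting-decomposition $(U,\Gamma)$ with respect to a (possibly implicit) set of tuples $\mathcal{Q}$, and an integer $\tau\ge 2$, computes an $f$-respecting-decomposition $(B,\Lambda)$ with respect to a set of tuples $\mathcal{Q}'$ which satisfies the following: 1. If $\langle s,t,F\rangle\in\mathcal{Q}$ is not captured by $(U,\Gamma)$, then $\langle a,b,F\rangle\in\mathcal{Q}'$ for every $\langle a,b\rangle\in U(s,F)\times U(t,F)$. 2. $|B|\le |U|/\tau$. 3. $\Delta(\Lambda)=\Delta(\Gamma)+O(\tau\cdot(f\log n)^{12})$.
   Context: For $u\in V$, $N^+(u)$ is the closed neighborhood of $u$ in $G$ (its neighbors together with $u$). For $F\subseteq V$, vertices $s,t\in V\setminus F$ are $F$-connected if they are connected in $G-F$. A decomposition $(U,\Gamma)$ consists of a vertex subset $U\subseteq V$ and a collection $\Gamma=\{\gamma_1,\dots,\gamma_k\}$ of mutually disjoint vertex subsets $\gamma_j\subseteq V$, each associated with a spanning tree $T(\gamma_j)$ of the induced graph $G[\gamma_j]$. $U$ may intersect $V(\Gamma)=\bigcup_j\gamma_j$. Its degree is $\Delta(\Gamma)=\max_j\Delta(T(\gamma_j))$, where $\Delta(T)$ denotes maximum degree (and $\Delta(\emptyset)=0$). A path $P$ in $G$ respects $(U,\Gamma)$ if for every segment (subpath) $P'$ of $P$ having no vertices of $U$ there is some $\gamma_j\in\Gamma$ with $V(P')\subseteq\gamma_j$. A triplet $\langle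 s,t,F\rangle$ respects $(U,\Gamma)$ if either $s,t$ are not $F$-connected, or $s,t$ are $F$-connected and there exists an $s$-$t$ path in $G-F$ that respects $(U,\Gamma)$. A triplet $\langle s,t,F\rangle$ is captured by $(U,\Gamma)$ if there is some $\gamma_j\in\Gamma$ such that $s,t$ are connected in $G[\gamma_j]-F$. For a set $\mathcal{Q}$ of triplets $\langle s,t,F\rangle$ with $F\subseteq V$, $|F|\le f$, $s,t\in V\setminus F$, the decomposition $(U,\Gamma)$ is an $f$-respecting-decomposition with respect to $\mathcal{Q}$ if every $\langle s,t,F\rangle\in\mathcal{Q}$ respects $(U,\Gamma)$. ''Possibly implicit'' means that $\mathcal{Q}$ need not be given to the algorithm (likewise $\mathcal{Q}'$ is not output). For a decomposition $(U,\Gamma)$, $F\subseteq V$ and $s\in V\setminus F$: if $s\in\gamma_j$ for some $\gamma_j\in\Gamma$, $U(s,F)$ is the set of all $u\in U-F$ such that $N^+(u)$ intersects the connected component of $s$ in $G[\gamma_j]-F$; if $s\in U-V(\Gamma)$, $U(s,F)=\{s\}$; otherwise $U(s,F)=\emptyset$. *)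

(* Defs.v *)
From Stdlib Require Import Reals.
From mathcomp Require Import all_boot.
Set Implicit Arguments.
Unset Strict Implicit.
Unset Printing Implicit Defensive.

(* The key R is taken over by ring_scope when all_boot is imported. *)
Delimit Scope R_scope with real.

Record sgraph (T : finType) := SGraph {
  adj : rel T;
  adj_sym : symmetric adj;
  adj_irr : irreflexive adj
}.

Section Graphs.
Variable T : finType.
Implicit Types (G H : sgraph T) (A : {set T}) (s t u x y : T) (p : seq T).

Definition closed_nbhd G u : {set T} := [set x | (x == u) || adj G u x].

Definition max_degree G : nat := \max_(x : T) #|[set y | adj G x y]|.

(* x and y are vertices of the induced subgraph G[A], connected in G[A].  The
   membership tests are needed because [connect] is reflexive on all of T. *)
Definition connected_in G A x y : bool :=
  [&& x \in A, y \in A &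
      connect [rel a b | [&& a \in A, b \in A & adj G a b]] x y].

Definition component_in G A x : {set T} := [set y | connected_in G A x y].

(* A symmetric relation always has the cycles [:: x; y] of length two; these
   are not cycles of the graph. *)
Definition acyclic G : Prop :=
  forall c : seq T, ucycle (adj G) c -> size c <= 2.

(* H, whose edges are all inside A, is a spanning tree of G[A]; the elements
   of T outside A are not regarded as vertices of H. *)
Definition spanning_tree G A H : Prop :=
  [/\ forall x y, adj H x y -> [&& x \in A, y \in A & adj G x y],
      forall x y, x \in A -> y \in A -> connect (adj H) x y
    & acyclic H].

(* s :: p is the vertex sequence of a (simple) s-t path of G[A]. *)
Definition is_path G A s t p : bool :=
  [&& path (adj G) s p, uniq (s :: p), last s p == t & all (mem A) (s :: p)].

End Graphs.

(* Gamma is the family (dgamma j)_(j < dsize), and dtree j is T(gamma_j). *)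
Record decomposition (T : finType) (G : sgraph T) := Decomposition {
  dU : {set T};
  dsize : nat;
  dgamma : 'I_dsize -> {set T};
  dtree : 'I_dsize -> sgraph T;
  dgamma_disjoint :
    forall i j : 'I_dsize, i != j -> [disjoint dgamma i & dgamma j];
  dtree_spanning :
    forall j : 'I_dsize, spanning_tree G (dgamma j) (dtree j)
}.

Section Decompositions.
Variables (T : finType) (G : sgraph T).
Implicit Types (D : decomposition G) (s t : T) (F : {set T}).

Definition decomp_degree D : nat := \max_(j < dsize D) max_degree (dtree j).

(* P lists the vertices of a path.  Segments are nonempty: the empty sequence
   is not a path. *)
Definition path_respects D (P : seq T) : Prop :=
  forall q : seq T, q != [::] -> infix q P ->
    (forall x, x \in q -> x \notin dU D) ->
    exists j : 'I_(dsize D), forall x, x \in q -> x \in dgamma j.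

Definition triplet_respects D s t F : Prop :=
  ~~ connected_in G (~: F) s t \/
  connected_in G (~: F) s t /\
  exists p : seq T, is_path G (~: F) s t p /\ path_respects D (s :: p).

Definition captured D s t F : Prop :=
  exists j : 'I_(dsize D), connected_in G (dgamma j :\: F) s t.

Definition respecting (f : nat) D (Q : {set T * T * {set T}}) : Prop :=
  forall s t F, (s, t, F) \in Q ->
    [/\ #|F| <= f, s \notin F, t \notin F & triplet_respects D s t F].

(* U(s, F); there is at most one j to pick, as the gamma_j are disjoint. *)
Definition Uset D s F : {set T} :=
  match [pick j : 'I_(dsize D) | s \in dgamma j] with
  | Some j =>
      [set u in dU D :\: F |
        closed_nbhd G u :&: component_in G (dgamma j :\: F) s != set0]
  | None => if s \in dU D then [set s] else set0
  end.

End Decompositions.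

(* Programs of a random access machine with finitely many registers (those
   mentioned in the program) and an unbounded memory, all holding natural
   numbers.  An operation costs one unit whatever the size of its operands;
   since there is no multiplication, the bit lengths of the numbers grow by at
   most a constant per unit of time, so that polynomial time on this machine
   is polynomial time on a Turing machine. *)
Inductive expr :=
  | Const of nat
  | Reg of nat
  | Read of expr
  | Add of expr & expr
  | Monus of expr & expr   (* truncated subtraction *)
  | Half of expr.

Inductive cmd :=
  | Skip
  | Assign of nat & expr
  | Write of expr & expr   (* address, value *)
  | Seq of cmd & cmd
  | If of expr & cmd & cmd (* tests for a nonzero value *)
  | While of expr & cmd.

Record state := State { regs : nat -> nat; mem_ : nat -> nat }.

Definition update (m : nat -> nat) (a v : nat) : nat -> nat :=
  fun x => if x == a then v else m x.

Fixpoint eval (s : state) (e : expr) : nat :=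
  match e with
  | Const k => k
  | Reg r => regs s r
  | Read e1 => mem_ s (eval s e1)
  | Add e1 e2 => eval s e1 + eval s e2
  | Monus e1 e2 => eval s e1 - eval s e2
  | Half e1 => (eval s e1)./2
  end.

Fixpoint ecost (e : expr) : nat :=
  match e with
  | Const _ | Reg _ => 1
  | Read e1 | Half e1 => (ecost e1).+1
  | Add e1 e2 | Monus e1 e2 => (ecost e1 + ecost e2).+1
  end.

(* exec c s k s' : started in state s, c halts in state s' after time k. *)
Inductive exec : cmd -> state -> nat -> state -> Prop :=
  | ExecSkip s : exec Skip s 1 s
  | ExecAssign r e s :
      exec (Assign r e) s (ecost e).+1
           (State (update (regs s) r (eval s e)) (mem_ s))
  | ExecWrite e1 e2 s :
      exec (Write e1 e2) s (ecost e1 + ecost e2).+1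
           (State (regs s) (update (mem_ s) (eval s e1) (eval s e2)))
  | ExecSeq c1 c2 s s1 s2 k1 k2 :
      exec c1 s k1 s1 -> exec c2 s1 k2 s2 ->
      exec (Seq c1 c2) s (k1 + k2).+1 s2
  | ExecIfTrue e c1 c2 s s1 k :
      eval s e != 0 -> exec c1 s k s1 ->
      exec (If e c1 c2) s (ecost e + k).+1 s1
  | ExecIfFalse e c1 c2 s s1 k :
      eval s e = 0 -> exec c2 s k s1 ->
      exec (If e c1 c2) s (ecost e + k).+1 s1
  | ExecWhileTrue e c s s1 s2 k1 k2 :
      eval s e != 0 -> exec c s k1 s1 -> exec (While e c) s1 k2 s2 ->
      exec (While e c) s (ecost e + k1 + k2).+1 s2
  | ExecWhileFalse e c s :
      eval s e = 0 -> exec (While e c) s (ecost e).+1 s.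

Lemma exec_deterministic c s k1 s1 k2 s2 :
  exec c s k1 s1 -> exec c s k2 s2 -> k1 = k2 /\ s1 = s2.
Proof.
move=> H; elim: H k2 s2 => {c s k1 s1} [s|r e s|e1 e2 s
  |c1 c2 s s1 s2 k1 k2 _ IH1 _ IH2|e c1 c2 s s1 k e0 _ IH
  |e c1 c2 s s1 k e0 _ IH|e c s s1 s2 k1 k2 e0 _ IH1 _ IH2|e c s e0] k' s' H;
  inversion H; subst => //; try by [rewrite e0 in H6 | rewrite H6 in e0].
all: try solve [repeat match goal with
  | IH : forall k s, exec _ _ k s -> _, E : exec _ _ _ _ |- _ =>
      have [? ?] := IH _ _ E; subst; clear IH end; by []
  | match goal with E : eval ?s ?e = 0, N : is_true (eval ?s ?e != 0) |- _ =>
      by rewrite E in N end].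
Qed.

(* Inputs and outputs are finite sequences of numbers, held in the first memory
   cells, with their length in register 0. *)
Definition init_state (inp : seq nat) : state :=
  State (fun r => if r == 0 then size inp else 0) (fun a => nth 0 inp a).

Definition output (s : state) : seq nat := mkseq (mem_ s) (regs s 0).

Definition computes (prog : cmd) (inp : seq nat) (time : nat) (out : seq nat) :
  Prop := exists s : state, exec prog (init_state inp) time s /\ output s = out.

(* Number of bits of the binary representations. *)
Definition bit_size (inp : seq nat) : nat :=
  \sum_(x <- inp) (trunc_log 2 x).+1.

Section Encodings.
Variable n : nat.

Definition enc_set (A : {set 'I_n}) : seq nat :=
  [seq nat_of_bool (x \in A) | x <- enum 'I_n].

Definition enc_graph (G : sgraph 'I_n) : seq nat :=
  [seq nat_of_bool (adj G x y) | x <- enum 'I_n, y <- enum 'I_n].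

Definition enc_decomp (G : sgraph 'I_n) (D : decomposition G) : seq nat :=
  enc_set (dU D) ++ dsize D ::
  flatten [seq enc_set (dgamma j) ++ enc_graph (dtree j)
          | j <- enum 'I_(dsize D)].

Definition enc_input (G : sgraph 'I_n) (f : nat) (D : decomposition G)
    (tau : nat) : seq nat :=
  [:: n; f; tau] ++ enc_graph G ++ enc_decomp D.

End Encodings.

(* Main.v *)
Require Import Defs.
From Stdlib Require Import Reals.
From mathcomp Require Import all_boot.
From Stdlib Require Import Lra FunctionalExtensionality.
From mathcomp Require Import zify.
Set Implicit Arguments.
Unset Strict Implicit.
Unset Printing Implicit Defensive.

(** A triplet respects a decomposition iff its endpoints are connected, off F,
    by edges of G that meet U or lie inside one gamma_j.  So it suffices that
    any a, b in U connected off F in this sense for (U, Gamma) remain so for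
    (B, Lambda).

    Sparsification.  Call j an edge of the hypergraph on U whose vertices are
    the elements of U with a neighbour in gamma_j.  For every modulus m up to
    M = O(f log n) and all residues a, b, restrict this hypergraph to the
    vertices congruent to a or b modulo m and extract f+1 successive spanning
    forests.  The set J of all hyperedges used has O((f log n)^4) |U| elements.
    If y and z lie on a hyperedge outside J but not in F, choose m separating
    both from F (it exists because the least common multiple of 1, ..., M
    exceeds the product of the differences); for the residues of y and z, one
    of the f+1 forests uses no gamma_i meeting F, and it connects y to z off F.  Hence
    all gamma_j with j outside J can be dropped.

    Low degree.  Let W be the union of U and the gamma_j, j in J.  Start from
    the trees T(gamma_j) and run Kruskal's algorithm on G[W], accepting an edge
    only if each end has received fewer than L = O(tau (f log n)^4) edges.  Let
    B be the vertices with L received edges and Lambda the components.  At most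
    |U| + |J| edges are accepted, so |B| <= |U| / tau, and every edge of G[W]
    meets B or lies inside a component.  A vertex of B stays in its component:
    only the added edges count towards its load. *)

(** * Compiling array programs to the random access machine *)

(** Faults strike the hypergraph in two ways. A vertex of F inside some gamma_j destroys a single
    hyperedge, because the gamma_j are disjoint; edge-disjoint forests are the remedy, one more of
    them than faults. A vertex of F inside U may lie on many hyperedges and cut all the forests at
    once; this is why the hypergraph is restricted to vertex classes, one of which contains y and z
    but no fault. Residue classes form a small explicit family of this kind, because with n <= 2^lg
    the product of the at most 2f relevant differences is at most 2^(2 f lg). The exponent 4 counts
    the modulus, the two residues and the forests.

    The algorithm never sees Q: it preserves the connections between vertices of U for all F with
    |F| <= f at once, hence serves every Q that (U, Gamma) respects. It is written in a small
    language whose loops have N rounds each, so that polynomial running time is a property of the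
    compiler and only the computed values remain to be analysed. *)

Inductive hexp :=
  | HC of nat
  | HV of nat
  | HIn of hexp
  | HA of nat & hexp
  | HAdd of hexp & hexp
  | HSub of hexp & hexp
  | HIte of hexp & hexp & hexp
  | HSum of nat & hexp.

Inductive hcmd :=
  | HTab of nat & nat & hexp
  | HSeq of hcmd & hcmd
  | HIf of hexp & hcmd
  | HFor of nat & hcmd
  | HEmit of hexp.

(* Sums and loops range over i < N, where N is the length of the input, so that
   every program runs in polynomial time.  HTab k r e sets the cells i < N of
   array k simultaneously to the values of e at r := i. *)
Section HighLevelSemantics.
Variable inp : seq nat.
Let N := size inp.

Fixpoint hev (A : nat -> nat -> nat) (v : nat -> nat) (e : hexp) : nat :=
  match e with
  | HC c => c
  | HV r => v r
  | HIn e1 => nth 0 inp (hev A v e1)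
  | HA k e1 => A k (hev A v e1)
  | HAdd e1 e2 => hev A v e1 + hev A v e2
  | HSub e1 e2 => hev A v e1 - hev A v e2
  | HIte e1 e2 e3 => if hev A v e1 != 0 then hev A v e2 else hev A v e3
  | HSum r e1 => \sum_(0 <= i < N) hev A (update v r i) e1
  end.

Definition tab (A : nat -> nat -> nat) (k : nat) (g : nat -> nat) :
    nat -> nat -> nat :=
  fun k' i => if (k' == k) && (i < N) then g i else A k' i.

Definition hstate : Type := (nat -> nat -> nat) * seq nat.

Fixpoint hrun (c : hcmd) (v : nat -> nat) (S : hstate) : hstate :=
  match c with
  | HTab k r e => (tab S.1 k (fun i => hev S.1 (update v r i) e), S.2)
  | HSeq c1 c2 => hrun c2 v (hrun c1 v S)
  | HIf e c1 => if hev S.1 v e != 0 then hrun c1 v S else S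
  | HFor r c1 => foldl (fun S i => hrun c1 (update v r i) S) S (iota 0 N)
  | HEmit e => (S.1, rcons S.2 (hev S.1 v e))
  end.

End HighLevelSemantics.

Definition nvar := 30.
Definition narr := 14.

Fixpoint wf_exp (e : hexp) : bool :=
  match e with
  | HC _ => true
  | HV r => r < nvar
  | HIn e1 => wf_exp e1
  | HA k e1 => (k < narr) && wf_exp e1
  | HAdd e1 e2 | HSub e1 e2 => wf_exp e1 && wf_exp e2
  | HIte e1 e2 e3 => [&& wf_exp e1, wf_exp e2 & wf_exp e3]
  | HSum r e1 => (r < nvar) && wf_exp e1
  end.

Fixpoint wf_cmd (c : hcmd) : bool :=
  match c with
  | HTab k r e => [&& k < narr, r < nvar & wf_exp e]
  | HSeq c1 c2 => wf_cmd c1 && wf_cmd c2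
  | HIf e c1 => wf_exp e && wf_cmd c1
  | HFor r c1 => (r < nvar) && wf_cmd c1
  | HEmit e => wf_exp e
  end.

(* Register 0 holds the input length N, register 1 the number of emitted
   values, registers 2, ..., 31 the variables; the others are temporaries.
   Cell i of array k is at address N + 16 i + k: arrays 14 and 15 are a scratch
   array and the emitted values. *)
Definition twice (e : expr) : expr := Add e e.
Definition cell (k : nat) (e : expr) : expr :=
  Add (Reg 0) (Add (twice (twice (twice (twice e)))) (Const k)).

Definition Loop (t : nat) (c : cmd) : cmd :=
  Seq (Assign t (Const 0))
      (While (Monus (Reg 0) (Reg t))
             (Seq c (Assign t (Add (Reg t) (Const 1))))).

(** Variables are local in the array language but live in global registers, so the old value is
    saved in the temporary [t] and put back afterwards. *)
Definition bind_var (t r : nat) (c : cmd) : cmd :=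
  Seq (Assign t (Reg r.+2)) (Seq c (Assign r.+2 (Reg t))).

(** The result is left in register [t]; only temporaries from [t] on are used, so that pending
    intermediate results below [t] survive. *)
Fixpoint cexp (e : hexp) (t : nat) : cmd :=
  match e with
  | HC c => Assign t (Const c)
  | HV r => Assign t (Reg r.+2)
  | HIn e1 => Seq (cexp e1 t) (If (Monus (Reg 0) (Reg t))
                                  (Assign t (Read (Reg t)))
                                  (Assign t (Const 0)))
  | HA k e1 => Seq (cexp e1 t) (Assign t (Read (cell k (Reg t))))
  | HAdd e1 e2 => Seq (cexp e1 t) (Seq (cexp e2 t.+1)
                      (Assign t (Add (Reg t) (Reg t.+1))))
  | HSub e1 e2 => Seq (cexp e1 t) (Seq (cexp e2 t.+1)
                      (Assign t (Monus (Reg t) (Reg t.+1))))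
  | HIte e1 e2 e3 => Seq (cexp e1 t) (If (Reg t) (cexp e2 t) (cexp e3 t))
  | HSum r e1 =>
      Seq (Assign t (Const 0))
       (bind_var t.+1 r (Loop t.+2
         (Seq (Assign r.+2 (Reg t.+2))
         (Seq (cexp e1 t.+3) (Assign t (Add (Reg t) (Reg t.+3)))))))
  end.

(** For [HTab], all values are collected in the scratch array before any of them is copied into
    array [k], because the expression may read array [k] itself. *)
Fixpoint ccmd (c : hcmd) (t : nat) : cmd :=
  match c with
  | HTab k r e =>
      bind_var t r (Seq
        (Loop t.+1 (Seq (Assign r.+2 (Reg t.+1))
                   (Seq (cexp e t.+2) (Write (cell narr (Reg t.+1)) (Reg t.+2)))))
        (Loop t.+1 (Write (cell k (Reg t.+1)) (Read (cell narr (Reg t.+1))))))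
  | HSeq c1 c2 => Seq (ccmd c1 t) (ccmd c2 t)
  | HIf e c1 => Seq (cexp e t) (If (Reg t) (ccmd c1 t.+1) Skip)
  | HFor r c1 =>
      bind_var t r (Loop t.+1 (Seq (Assign r.+2 (Reg t.+1)) (ccmd c1 t.+2)))
  | HEmit e => Seq (cexp e t) (Seq (Write (cell narr.+1 (Reg 1)) (Reg t))
                                   (Assign 1 (Add (Reg 1) (Const 1))))
  end.

Lemma update_same m a v : update m a v a = v.
Proof. by rewrite /update eqxx. Qed.

Lemma update_other m a v x : x != a -> update m a v x = m x.
Proof. by rewrite /update => /negbTE ->. Qed.

(** * Polynomial bounds and timed Hoare rules for machine commands *)

Definition poly_bounded (g : nat -> nat) : Prop :=
  exists c d, forall N, g N <= c * N.+1 ^ d.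

Lemma poly_bounded_const c : poly_bounded (fun=> c).
Proof. by exists c, 0 => N; rewrite expn0 muln1. Qed.

Lemma poly_bounded_add g h :
  poly_bounded g -> poly_bounded h -> poly_bounded (fun N => g N + h N).
Proof.
move=> [c [d gP]] [c' [d' hP]]; exists (c + c'), (d + d') => N.
rewrite mulnDl; apply: leq_add.
- by apply: leq_trans (gP N) _; rewrite leq_mul2l leq_pexp2l ?leq_addr ?orbT.
- by apply: leq_trans (hP N) _; rewrite leq_mul2l leq_pexp2l ?leq_addl ?orbT.
Qed.

Lemma poly_bounded_mulN g :
  poly_bounded g -> poly_bounded (fun N => N * g N).
Proof.
move=> [c [d gP]]; exists c, d.+1 => N.
by rewrite expnS mulnCA leq_mul // ltnW.
Qed.

(** Total correctness with a time bound: the lemmas below are the rules of the corresponding Hoare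
    logic. *)
Definition steps (c : cmd) (s : state) (b : nat) (P : state -> Prop) : Prop :=
  exists k s', [/\ exec c s k s', k <= b & P s'].

Lemma steps_le c s b b' P : b <= b' -> steps c s b P -> steps c s b' P.
Proof.
by move=> bb' [k [s' [H1 H2 H3]]]; exists k, s'; split=> //; apply: leq_trans bb'.
Qed.

Lemma steps_weaken c s b (P P' : state -> Prop) :
  (forall s', P s' -> P' s') -> steps c s b P -> steps c s b P'.
Proof. by move=> PP' [k [s' [H1 H2 /PP' H3]]]; exists k, s'. Qed.

Lemma steps_seq c1 c2 s b1 b2 (P1 P2 : state -> Prop) :
  steps c1 s b1 P1 -> (forall s', P1 s' -> steps c2 s' b2 P2) ->
  steps (Seq c1 c2) s (b1 + b2).+1 P2.
Proof.
move=> [k1 [s1 [e1 l1 H1]]] /(_ s1 H1) [k2 [s2 [e2 l2 H2]]].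
exists (k1 + k2).+1, s2; split=> //; first exact: ExecSeq e1 e2.
by rewrite ltnS leq_add.
Qed.

Lemma steps_assign r e s (P : state -> Prop) :
  P (State (update (regs s) r (eval s e)) (mem_ s)) ->
  steps (Assign r e) s (ecost e).+1 P.
Proof. by move=> H; eexists _, _; split; [exact: ExecAssign|exact: leqnn|]. Qed.

Lemma steps_write e1 e2 s (P : state -> Prop) :
  P (State (regs s) (update (mem_ s) (eval s e1) (eval s e2))) ->
  steps (Write e1 e2) s (ecost e1 + ecost e2).+1 P.
Proof. by move=> H; eexists _, _; split; [exact: ExecWrite|exact: leqnn|]. Qed.

Lemma steps_skip s (P : state -> Prop) : P s -> steps Skip s 1 P.
Proof. by move=> H; exists 1, s; split=> //; exact: ExecSkip. Qed.

Lemma steps_if e c1 c2 s b1 b2 (P : state -> Prop) :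
  (eval s e != 0 -> steps c1 s b1 P) -> (eval s e = 0 -> steps c2 s b2 P) ->
  steps (If e c1 c2) s (ecost e + (b1 + b2)).+1 P.
Proof.
move=> H1 H2; have [e0|e0] := eqVneq (eval s e) 0.
- have [k [s' [h1 h2 h3]]] := H2 e0.
  exists (ecost e + k).+1, s'; split=> //; first exact: ExecIfFalse.
  by rewrite ltnS leq_add2l (leq_trans h2) ?leq_addl.
- have [k [s' [h1 h2 h3]]] := H1 e0.
  exists (ecost e + k).+1, s'; split=> //; first exact: ExecIfTrue.
  by rewrite ltnS leq_add2l (leq_trans h2) ?leq_addr.
Qed.

Lemma steps_while (m t : nat) c s b (P : nat -> state -> Prop) :
  (forall i s', P i s' -> [/\ regs s' 0 = m, regs s' t = i & i <= m]) ->
  P 0 s ->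
  (forall i s', i < m -> P i s' -> steps c s' b (P i.+1)) ->
  steps (While (Monus (Reg 0) (Reg t)) c) s ((b + 5) * m + 4) (P m).
Proof.
move=> Preg P0 Pstep.
have [i [im Pi]] : exists i, i <= m /\ P i s by exists 0.
rewrite -[in X in (b + 5) * X](subn0 m).
have: (b + 5) * (m - i) + 4 <= (b + 5) * (m - 0) + 4 by rewrite leq_add2r leq_mul2l; lia.
move=> le1; apply: (steps_le le1); clear le1 P0.
move: {2}(m - i) (erefl (m - i)) => q Eq.
elim: q i Eq s im Pi => [|q IH] i Eq s im Pi.
  have Ei : i = m by lia.
  subst i; have [h1 h2 _] := Preg _ _ Pi.
  exists 4, s; split; [|exact: leq_addl|by []].
  apply: (ExecWhileFalse (e := Monus (Reg 0) (Reg t))).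
  by rewrite /= h1 h2 subnn.
have lim : i < m by lia.
have [h1 h2 _] := Preg _ _ Pi.
have [k1 [s1 [e1 l1 P1]]] := Pstep i s lim Pi.
have Eq1 : m - i.+1 = q by lia.
have [k2 [s2 [e2 l2 P2]]] := IH i.+1 Eq1 s1 lim P1.
exists (3 + k1 + k2).+1, s2; split=> //.
- apply: (ExecWhileTrue (e := Monus (Reg 0) (Reg t))) e1 e2.
  by rewrite /= h1 h2; lia.
- by rewrite Eq1 in l2; rewrite Eq mulnS; lia.
Qed.

Lemma steps_loop (m t : nat) c s b (P : nat -> state -> Prop) :
  0 != t ->
  (forall i s', P i s' -> [/\ regs s' 0 = m, regs s' t = i & i <= m]) ->
  P 0 (State (update (regs s) t 0) (mem_ s)) ->
  (forall i s', i < m -> P i s' ->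
     steps c s' b (fun s'' => P i.+1 (State (update (regs s'') t (regs s'' t).+1)
                                      (mem_ s'')))) ->
  steps (Loop t c) s ((b + 10) * m + 7) (P m).
Proof.
move=> t0 Preg P0 Pstep; rewrite /Loop.
apply: (@steps_le _ _ (2 + ((b + 5 + 5) * m + 4)).+1); first lia.
apply: (@steps_seq _ _ _ _ _ (P 0)); first exact: steps_assign.
move=> s' P0'; apply: steps_while => // i s1 im P1.
apply: (@steps_le _ _ (b + 4).+1); first lia.
apply: (steps_seq (Pstep i s1 im P1)) => s2 P2.
by apply: steps_assign; rewrite /= addn1.
Qed.

Lemma eval_cell k e s : eval s (cell k e) = regs s 0 + 16 * eval s e + k.
Proof. by rewrite /=; lia. Qed.

(** * Simulation of the array language by compiled code *)

Definition represents (inp : seq nat) (A : nat -> nat -> nat) (v : nat -> nat)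
    (s : state) : Prop :=
  [/\ regs s 0 = size inp,
      forall r, r < nvar -> regs s r.+2 = v r,
      forall i, i < size inp -> mem_ s i = nth 0 inp i
    & forall k i, k < narr -> mem_ s (size inp + 16 * i + k) = A k i].

Definition regs_below (t : nat) (s s' : state) : Prop :=
  forall r, r < t -> regs s' r = regs s r.

Lemma represents_regs inp A v s s' t :
  nvar.+1 < t -> regs_below t s s' -> mem_ s' = mem_ s ->
  represents inp A v s -> represents inp A v s'.
Proof.
move=> tn ss' mm [h1 h2 h3 h4]; split.
- by rewrite ss' //; lia.
- by move=> r rn; rewrite ss' ?h2 //; lia.
- by rewrite mm.
- by rewrite mm.
Qed.

Definition exp_post inp A v e t s s' : Prop :=
  [/\ mem_ s' = mem_ s, regs_below t s s' & regs s' t = hev inp A v e].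

(** The bound depends on the input length alone, uniformly in arrays, variables and state; this is
    what allows a loop to multiply it by N. *)
Definition exp_correct (e : hexp) (b : nat -> nat) : Prop :=
  forall inp A v s t, nvar.+1 < t -> represents inp A v s ->
    steps (cexp e t) s (b (size inp)) (exp_post inp A v e t s).

Ltac upd := repeat first [rewrite update_same | rewrite update_other; [|by lia]].

Lemma represents_bind inp A v s r x :
  r < nvar -> represents inp A v s ->
  represents inp A (update v r x)
    (State (update (regs s) r.+2 x) (mem_ s)).
Proof.
move=> rn [h1 h2 h3 h4]; split=> //= r' rn'.
by rewrite /update !eqSS; case: eqP => // _; apply: h2.
Qed.

Lemma cexp_correct e : wf_exp e -> exists b, poly_bounded b /\ exp_correct e b.
Proof.
elim: e => [c|r|e IH|k e IH|e1 IH1 e2 IH2|e1 IH1 e2 IH2|e1 IH1 e2 IH2 e3 IH3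
           |r e IH] /=.
- move=> _; exists (fun=> 2); split; first exact: poly_bounded_const.
  move=> inp A v s t tn R; apply: steps_assign; split=> //=.
  + by move=> r rt /=; upd.
  + by upd.
- move=> rn; exists (fun=> 2); split; first exact: poly_bounded_const.
  move=> inp A v s t tn [h1 h2 h3 h4]; apply: steps_assign; split=> //=.
  + by move=> r' rt /=; upd.
  + by upd; rewrite h2.
- move=> /IH [b [bp bc]]; exists (fun N => b N + 20).
  split; first by apply: poly_bounded_add => //; apply: poly_bounded_const.
  move=> inp A v s t tn R.
  apply: (@steps_le _ _ (b (size inp) + (3 + (3 + 2)).+1).+1); first lia.
  apply: (steps_seq (bc _ _ _ _ _ tn R)) => s1 [m1 r1 v1].
  have [h1 h2 h3 h4] := represents_regs tn r1 m1 R.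
  apply: steps_if => /=; rewrite h1 v1 => H; apply: steps_assign; split=> //=.
  + by move=> r' rt /=; upd; apply: r1.
  + by upd; rewrite v1 h3 //; lia.
  + by move=> r' rt /=; upd; apply: r1.
  + by upd; rewrite nth_default //; lia.
- move=> /andP[kn /IH [b [bp bc]]]; exists (fun N => b N + 60).
  split; first by apply: poly_bounded_add => //; apply: poly_bounded_const.
  move=> inp A v s t tn R.
  apply: (@steps_le _ _ (b (size inp) + (ecost (Read (cell k (Reg t)))).+1).+1).
    by rewrite /=; lia.
  apply: (steps_seq (bc _ _ _ _ _ tn R)) => s1 [m1 r1 v1].
  have [h1 h2 h3 h4] := represents_regs tn r1 m1 R.
  apply: steps_assign; split=> //=.
  + by move=> r' rt /=; upd; apply: r1.
  + upd; rewrite h1 v1 -h4 //; congr (mem_ _ _); lia.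
- move=> /andP[/IH1 [b1 [bp1 bc1]] /IH2 [b2 [bp2 bc2]]].
  exists (fun N => b1 N + (b2 N + 20)).
  split; first by do 2!apply: poly_bounded_add => //; apply: poly_bounded_const.
  move=> inp A v s t tn R.
  apply: (@steps_le _ _ (b1 (size inp) + (b2 (size inp) + 4).+1).+1); first lia.
  apply: (steps_seq (bc1 _ _ _ _ _ tn R)) => s1 [m1 r1 v1].
  have R1 := represents_regs tn r1 m1 R.
  apply: (steps_seq (bc2 _ _ _ _ _ (leqW tn) R1)) => s2 [m2 r2 v2].
  apply: steps_assign; split=> /=.
  + by rewrite m2 m1.
  + by move=> r' rt /=; upd; rewrite r2 ?r1 //; lia.
  + by upd; rewrite v2 r2 // v1.
- move=> /andP[/IH1 [b1 [bp1 bc1]] /IH2 [b2 [bp2 bc2]]].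
  exists (fun N => b1 N + (b2 N + 20)).
  split; first by do 2!apply: poly_bounded_add => //; apply: poly_bounded_const.
  move=> inp A v s t tn R.
  apply: (@steps_le _ _ (b1 (size inp) + (b2 (size inp) + 4).+1).+1); first lia.
  apply: (steps_seq (bc1 _ _ _ _ _ tn R)) => s1 [m1 r1 v1].
  have R1 := represents_regs tn r1 m1 R.
  apply: (steps_seq (bc2 _ _ _ _ _ (leqW tn) R1)) => s2 [m2 r2 v2].
  apply: steps_assign; split=> /=.
  + by rewrite m2 m1.
  + by move=> r' rt /=; upd; rewrite r2 ?r1 //; lia.
  + by upd; rewrite v2 r2 // v1.
- move=> /and3P[/IH1 [b1 [bp1 bc1]] /IH2 [b2 [bp2 bc2]] /IH3 [b3 [bp3 bc3]]].
  exists (fun N => b1 N + (b2 N + (b3 N + 20))).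
  split; first by do 3!apply: poly_bounded_add => //; apply: poly_bounded_const.
  move=> inp A v s t tn R; set N := size inp.
  apply: (@steps_le _ _ (b1 N + (1 + (b2 N + b3 N)).+1).+1); first lia.
  apply: (steps_seq (bc1 _ _ _ _ _ tn R)) => s1 [m1 r1 v1].
  have R1 := represents_regs tn r1 m1 R.
  apply: steps_if => /=; rewrite v1 => H.
  + rewrite /exp_post /= H; apply: steps_weaken (bc2 _ _ _ _ _ tn R1) => s2 [m2 r2 v2].
    by split; [rewrite m2|move=> r' rt; rewrite r2 ?r1|].
  + rewrite /exp_post /= H eqxx /=.
    apply: steps_weaken (bc3 _ _ _ _ _ tn R1) => s2 [m2 r2 v2].
    by split; [rewrite m2|move=> r' rt; rewrite r2 ?r1|].
- move=> /andP[rn /IH [b [bp bc]]]; exists (fun N => N * (b N + 30) + 40).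
  split.
    apply: poly_bounded_add; last exact: poly_bounded_const.
    apply: poly_bounded_mulN; apply: poly_bounded_add => //.
    exact: poly_bounded_const.
  move=> inp A v s t tn R; set N := size inp.
  apply: (@steps_le _ _
    (2 + (2 + (((2 + (b N + 4).+1).+1 + 10) * N + 7 + 2).+1).+1).+1).
    by rewrite mulnC; lia.
  rewrite /nvar in rn tn *.
  pose s0 := State (update (update (regs s) t 0) t.+1 (regs s r.+2)) (mem_ s).
  apply: (@steps_seq _ _ _ _ _ (fun s' => s' = State (update (regs s) t 0) (mem_ s))).
    exact: steps_assign.
  move=> _ ->; apply: (@steps_seq _ _ _ _ _ (fun s' => s' = s0)).
    by apply: steps_assign; rewrite /s0 /=; upd.
  move=> _ ->.
  (* Register [r.+2] is exempt from the frame clause: it carries the summation variable and is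
     restored from [t.+1] at the end. *)
  pose P i s' := [/\ mem_ s' = mem_ s,
    forall r', r' < t -> r' != r.+2 -> regs s' r' = regs s r',
    regs s' t = \sum_(0 <= i < i) hev inp A (update v r i) e,
    regs s' t.+1 = regs s r.+2 & regs s' t.+2 = i /\ i <= N].
  have PR i s' : P i s' ->
      represents inp A (update v r i) (State (update (regs s') r.+2 i) (mem_ s')).
    move=> [p1 p2 p3 p4 p5]; have [h1 h2 h3 h4] := R; split=> /=.
    + by upd; rewrite p2 ?h1 //; lia.
    + move=> r' rn'; rewrite /update !eqSS; case: eqP => // /eqP rr'.
      by rewrite p2 ?eqSS ?h2 //; rewrite /nvar in rn'; lia.
    + by rewrite p1.
    + by rewrite p1.
  apply: (@steps_seq _ _ _ _ _ (P N)).
    apply: steps_loop => //.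
    + move=> i s' [p1 p2 p3 p4 [p5 p6]]; split=> //.
      by rewrite p2 //; [case: R | lia].
    + split=> //=.
      * by move=> r' rt rr; upd.
      * by upd; rewrite big_geq.
      * by upd.
      * by upd.
    move=> i s' iN Ps'; have R' := PR _ _ Ps'.
    have [p1 p2 p3 p4 [p5 _]] := Ps'.
    apply: (@steps_seq _ _ _ _ _ (fun s1 =>
       s1 = State (update (regs s') r.+2 i) (mem_ s'))).
      by apply: steps_assign; rewrite /= p5.
    move=> _ ->.
    have tn3 : nvar.+1 < t.+3 by rewrite /nvar; lia.
    apply: (steps_seq (bc _ _ _ _ _ tn3 R')) => s2 [m2 r2 v2] /=.
    apply: steps_assign; split=> /=.
    + by rewrite m2.
    + move=> r' rt rr; upd; rewrite r2 /=; last lia.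
      by upd; apply: p2.
    + upd; rewrite v2 r2 /=; last lia.
      by upd; rewrite p3 big_nat_recr.
    + by upd; rewrite r2 /=; last lia; upd.
    + by upd; rewrite r2 /=; last lia; upd; rewrite p5.
  move=> s1 [p1 p2 p3 p4 _]; apply: steps_assign; split=> //=.
  + move=> r' rt /=; rewrite /update; case: eqP => [->|/eqP rr]; first by [].
    exact: p2.
  + by upd.
Qed.

Definition represents_out inp (S : hstate) v s : Prop :=
  [/\ represents inp S.1 v s, regs s 1 = size S.2
    & forall i, i < size S.2 -> mem_ s (size inp + 16 * i + narr.+1) = nth 0 S.2 i].

(** Register 1 counts the emitted values and so escapes the frame clause; register 0 is fixed by
    [represents]. The last clause bounds the amount of output by the time bound, which makes the
    final copying polynomial. *)
Definition cmd_post inp S c v t b s s' : Prop :=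
  [/\ represents_out inp (hrun inp c v S) v s',
      forall r, 1 < r -> r < t -> regs s' r = regs s r
    & size (hrun inp c v S).2 <= size S.2 + b].

Definition cmd_correct (c : hcmd) (b : nat -> nat) : Prop :=
  forall inp S v s t, nvar.+1 < t -> represents_out inp S v s ->
    steps (ccmd c t) s (b (size inp)) (cmd_post inp S c v t (b (size inp)) s).

Lemma represents_out_exp inp A o v e s s' t :
  nvar.+1 < t -> exp_post inp A v e t s s' ->
  represents_out inp (A, o) v s -> represents_out inp (A, o) v s'.
Proof.
move=> tn [m1 r1 v1] [R h1 h2]; split=> /=.
- exact: (represents_regs tn r1 m1 R).
- by rewrite r1 ?h1 //; lia.
- by move=> i io; rewrite m1 h2.
Qed.

Lemma represents_out_bind inp S v s r x :
  r < nvar -> represents_out inp S v s ->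
  represents_out inp S (update v r x) (State (update (regs s) r.+2 x) (mem_ s)).
Proof. by move=> rn [R h1 h2]; split=> //; apply: represents_bind. Qed.

Lemma represents_out_frame inp S v s s' :
  represents_out inp S v s -> mem_ s' = mem_ s ->
  (forall r, r < nvar.+2 -> regs s' r = regs s r) -> represents_out inp S v s'.
Proof.
move=> [[h1 h2 h3 h4] h5 h6] mm rr; split; first split.
- by rewrite rr.
- by move=> r rn; rewrite rr ?h2.
- by rewrite mm.
- by rewrite mm.
- by rewrite rr.
- by rewrite mm.
Qed.

Lemma update_update m a x y : update (update m a x) a y =1 update m a y.
Proof. by move=> z; rewrite /update; case: eqP. Qed.

Lemma represents_out_unbind inp S v s r x :
  r < nvar -> represents_out inp S (update v r x) s ->
  represents_out inp S v (State (update (regs s) r.+2 (v r)) (mem_ s)).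
Proof.
move=> rn [[h1 h2 h3 h4] h5 h6]; split=> //; split=> //= r' rn'.
rewrite /update !eqSS; case: eqP => [->//|/eqP rr].
by rewrite h2 // update_other.
Qed.

Lemma ccmd_correct_tab k r e :
  wf_cmd (HTab k r e) -> exists b, poly_bounded b /\ cmd_correct (HTab k r e) b.
Proof.
move=> /and3P[kn rn /cexp_correct [b [bp bc]]].
exists (fun N => N * (b N + 200) + 40); split.
  apply: poly_bounded_add; last exact: poly_bounded_const.
  apply: poly_bounded_mulN; apply: poly_bounded_add => //.
  exact: poly_bounded_const.
move=> inp [A o] v s t tn R; set N := size inp.
set bd := N * _ + _.
have [[g1 g2 g3 g4] g5 g6] := R; rewrite /= in g1 g2 g3 g4 g5 g6.
set g := fun i => hev inp A (update v r i) e.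
have [kn' rn'] : k < 14 /\ r < 30 by [].
have tn' : 31 < t by [].
pose frame s' := [/\ regs s' 0 = N, regs s' 1 = size o,
  forall r', r' < t -> r' != r.+2 -> regs s' r' = regs s r' & regs s' t = v r].
pose mems s' := [/\ forall i, i < N -> mem_ s' i = nth 0 inp i &
  forall i, i < size o -> mem_ s' (N + 16 * i + 15) = nth 0 o i].
pose scratch s' i := forall i', i' < i -> mem_ s' (N + 16 * i' + 14) = g i'.
(* [P i]: the first [i] values are in the scratch array and the arrays are unchanged. [Q i]: all
   values are in the scratch array and the first [i] of them have reached array [k]. *)
pose P i s' := [/\ frame s', mems s', scratch s' i,
   forall k' i', k' < 14 -> mem_ s' (N + 16 * i' + k') = A k' i'
   & regs s' t.+1 = i /\ i <= N].
pose Q i s' := [/\ frame s', mems s', scratch s' N,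
   forall k' i', k' < 14 -> mem_ s' (N + 16 * i' + k') =
        if (k' == k) && (i' < i) then g i' else A k' i'
   & regs s' t.+1 = i /\ i <= N].
apply: (@steps_le _ _ (2 + ((((2 + (b N + 45).+1).+1 + 10) * N + 7 +
   ((80 + 10) * N + 7)).+1 + 2).+1).+1).
  by rewrite /bd mulnC; lia.
apply: (@steps_seq _ _ _ _ _ (fun s' => s' = State (update (regs s) t (v r)) (mem_ s))).
  by apply: steps_assign; rewrite /= g2.
move=> _ ->; apply: (@steps_seq _ _ _ _ _ (Q N)); last first.
  move=> s' [[f0 f1 f2 f3] [m1 m2] sc ar [c1 _]]; apply: steps_assign.
  split=> /=.
  - split; first split=> /=.
    + by upd.
    + move=> r' rn2; rewrite /update !eqSS; case: eqP => [->|/eqP rr]; first by rewrite f3.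
      rewrite /nvar in rn2; rewrite f2 ?g2 //; lia.
    + by [].
    + by move=> k' i' kn2; rewrite ar.
    + by upd.
    + by move=> i io; rewrite m2.
  - move=> r' r1 rt; rewrite /update; case: eqP => [->|/eqP rr].
      by rewrite f3 g2.
    exact: f2.
  - exact: leq_addr.
apply: (@steps_seq _ _ _ _ _ (P N)).
  apply: steps_loop => //.
  - by move=> i s' [[f0 _ _ _] _ _ _ [c1 c2]].
  - split=> //=.
    + split=> /=; upd=> //.
      by move=> r' rt rr; upd.
    + by upd.
  move=> i s' iN [[f0 f1 f2 f3] [m1 m2] sc ar [c1 _]].
  pose s1 := State (update (regs s') r.+2 i) (mem_ s').
  apply: (@steps_seq _ _ _ _ _ (fun s2 => s2 = s1)).
    by apply: steps_assign; rewrite /= c1.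
  move=> _ ->.
  have R1 : represents inp A (update v r i) s1.
    split=> //= r' rn2; rewrite /update !eqSS; case: eqP => // /eqP rr.
    rewrite /nvar in rn2; rewrite f2 ?g2 //; lia.
  have tn2 : nvar.+1 < t.+2 by rewrite /nvar; lia.
  apply: (@steps_le _ _ (b N + (ecost (cell narr (Reg t.+1)) + 1).+1).+1).
    by rewrite /=; lia.
  apply: (steps_seq (bc _ _ _ _ _ tn2 R1)) => s2 [mm2 r2 v2].
  apply: steps_write; rewrite eval_cell /= r2 /=; last lia.
  rewrite r2; last lia.
  rewrite /s1 /=; upd; rewrite f0 c1 v2 mm2 /narr.
  split=> /=.
  - split=> /=; upd.
    + by rewrite r2 /=; last lia; upd.
    + by rewrite r2 /=; last lia; upd.
    + by move=> r' rt rr; upd; rewrite r2 /=; last lia; upd; apply: f2.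
    + by rewrite r2 /=; last lia; upd.
  - split=> i' hi /=; upd; [exact: m1|exact: m2].
  - move=> i' hi /=; rewrite /update; case: eqP => [h|h]; last by apply: sc; lia.
    by rewrite (_ : i' = i) //; lia.
  - by move=> k' i' hk; upd; apply: ar.
  - by upd.
move=> s1 [[f0 f1 f2 f3] [m1 m2] sc ar [c1 _]].
apply: steps_loop => //.
- by move=> i s' [[h0 _ _ _] _ _ _ [c3 c4]].
- split=> //=.
  + split=> /=; upd=> //.
    by move=> r' rt rr; upd; apply: f2.
  + by move=> k' i' hk; rewrite ltn0 andbF ar.
  + by upd.
clear s1 f0 f1 f2 f3 m1 m2 sc ar c1.
move=> i s' iN [[f0 f1 f2 f3] [m1 m2] sc ar [c1 _]].
apply: (@steps_le _ _ (ecost (cell k (Reg t.+1)) +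
    ecost (Read (cell narr (Reg t.+1)))).+1); first by rewrite /=; lia.
apply: steps_write.
have -> : eval s' (Read (cell narr (Reg t.+1))) = g i.
  by rewrite -sc //= f0 c1 /narr; congr (mem_ _ _); lia.
rewrite eval_cell /= f0 c1; split=> /=.
- split=> /=; upd=> //.
  by move=> r' rt rr; upd; apply: f2.
- split=> i' hi /=; upd; [exact: m1|exact: m2].
- by move=> i' hi /=; upd; apply: sc.
- move=> k' i' hk; rewrite /update; case: eqP => [h|h].
    (* The address determines array and cell, since array indices are below the stride 16. *)
    have [-> ->] : i' = i /\ k' = k by lia.
    by rewrite eqxx leqnn.
  rewrite ar //; case: eqP => [kk|//] /=; congr (if _ then _ else _); lia.
- by upd.
Qed.

Lemma ccmd_correct c : wf_cmd c -> exists b, poly_bounded b /\ cmd_correct c b.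
Proof.
elim: c => [k r e|c1 IH1 c2 IH2|e c IH|r c IH|e] /=.
- exact: ccmd_correct_tab.
- move=> /andP[/IH1 [b1 [bp1 bc1]] /IH2 [b2 [bp2 bc2]]].
  exists (fun N => b1 N + (b2 N + 1)).
  split; first by do 2!apply: poly_bounded_add => //; apply: poly_bounded_const.
  move=> inp S v s t tn R; set N := size inp.
  apply: (@steps_le _ _ (b1 N + b2 N).+1); first lia.
  apply: (steps_seq (bc1 _ _ _ _ _ tn R)) => s1 [R1 r1 l1].
  apply: steps_weaken (bc2 _ _ _ _ _ tn R1) => s2 [R2 r2 l2].
  split=> //; first by move=> r h1 h2; rewrite r2 ?r1.
  by move: l1 l2; rewrite -/N /=; lia.
- move=> /andP[/cexp_correct [b1 [bp1 bc1]] /IH [b2 [bp2 bc2]]].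
  exists (fun N => b1 N + (b2 N + 10)).
  split; first by do 2!apply: poly_bounded_add => //; apply: poly_bounded_const.
  move=> inp [A o] v s t tn R; set N := size inp.
  apply: (@steps_le _ _ (b1 N + (1 + (b2 N + 1)).+1).+1); first lia.
  have [R0 _ _] := R.
  apply: (steps_seq (bc1 _ _ _ _ _ tn R0)) => s1 E1.
  have R1 := represents_out_exp tn E1 R; have [m1 r1 v1] := E1.
  apply: steps_if => /=; rewrite v1 => H.
    apply: steps_weaken (bc2 _ _ _ _ _ (leqW tn) R1) => s2 [R2 r2 l2].
    rewrite /cmd_post /= H; split=> //.
      by move=> r h1 h2; rewrite r2 ?r1 //; lia.
    by move: l2; rewrite -/N /=; lia.
  apply: steps_skip; rewrite /cmd_post /= H eqxx /=; split=> //.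
    by move=> r h1 h2; rewrite r1.
  exact: leq_addr.
- move=> /andP[rn /IH [b [bp bc]]]; exists (fun N => N * (b N + 30) + 40).
  split.
    apply: poly_bounded_add; last exact: poly_bounded_const.
    apply: poly_bounded_mulN; apply: poly_bounded_add => //.
    exact: poly_bounded_const.
  move=> inp S v s t tn R; set N := size inp.
  set bd := N * _ + _.
  apply: (@steps_le _ _ (2 + ((((2 + b N).+1 + 10) * N + 7) + 2).+1).+1).
    by rewrite /bd mulnC; lia.
  have [rn' tn'] : r < 30 /\ 31 < t by [].
  have [[g1 g2 g3 g4] g5 g6] := R.
  apply: (@steps_seq _ _ _ _ _ (fun s' => s' = State (update (regs s) t (v r)) (mem_ s))).
    by apply: steps_assign; rewrite /= g2.
  move=> _ ->.
  pose F S i := hrun inp c (update v r i) S.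
  (* The invariant speaks of the state with variable [r] reset to its outer value, because between
     two rounds its register still holds the index of the last one. *)
  pose P i s' := [/\ represents_out inp (foldl F S (iota 0 i)) v
       (State (update (regs s') r.+2 (v r)) (mem_ s')),
    forall r', 1 < r' -> r' < t -> r' != r.+2 -> regs s' r' = regs s r',
    regs s' t = v r,
    regs s' t.+1 = i /\ i <= N
    & size (foldl F S (iota 0 i)).2 <= size S.2 + i * b N].
  apply: (@steps_seq _ _ _ _ _ (P N)); last first.
    move=> s' [R' r' c' _ l']; apply: steps_assign; rewrite /= c'; split=> //=.
    + move=> q q1 qt; rewrite /update; case: eqP => [->|/eqP qr]; first by rewrite g2.
      exact: r'.
    + by apply: leq_trans l' _; rewrite leq_add2l /bd mulnDr; lia.
  apply: steps_loop => //.
  + by move=> i s' [[[h1 _ _ _] _ _] _ _ [c1 c2] _].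
  + split=> /=.
    * apply: represents_out_frame R _ _ => //= q qn.
      rewrite /update; case: eqP => [->|_]; first by rewrite g2.
      by rewrite /nvar in qn; do 2![case: eqP => [|_]; first lia].
    * by move=> r' h1 h2 h3; upd.
    * by upd.
    * by upd.
    * by rewrite mul0n addn0.
  move=> i s' iN [R' r' c' [c1 _] l'].
  pose s1 := State (update (regs s') r.+2 i) (mem_ s').
  apply: (@steps_seq _ _ _ _ _ (fun s2 => s2 = s1)).
    by apply: steps_assign; rewrite /= c1.
  move=> _ ->.
  have R1 : represents_out inp (foldl F S (iota 0 i)) (update v r i) s1.
    apply: represents_out_frame (represents_out_bind i rn R') _ _ => //= q qn.
    by rewrite update_update.
  have tn2 : nvar.+1 < t.+2 by rewrite /nvar; lia.
  apply: steps_weaken (bc _ _ _ _ _ tn2 R1) => s2 [R2 r2 l2].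
  have FS : foldl F S (iota 0 i.+1) = F (foldl F S (iota 0 i)) i.
    by rewrite -addn1 iotaD foldl_cat.
  split.
  + rewrite FS.
    apply: represents_out_frame (represents_out_unbind rn R2) _ _ => //= q qn.
    rewrite /update; case: eqP => // _; case: eqP => // qt.
    by rewrite /nvar in qn; lia.
  + by move=> q h1 h2 h3 /=; upd; rewrite r2 //=; last lia; upd; apply: r'.
  + by rewrite /=; upd; rewrite r2 /=; [upd|lia|lia].
  + by rewrite /=; upd; rewrite r2 /=; [upd; rewrite c1|lia|lia].
  + by rewrite FS mulSn; move: l2 l'; rewrite -/N /F; lia.
- move=> /cexp_correct [b [bp bc]].
  exists (fun N => b N + 60).
  split; first by apply: poly_bounded_add => //; apply: poly_bounded_const.
  move=> inp [A o] v s t tn R; set N := size inp.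
  have tn' : 31 < t by [].
  apply: (@steps_le _ _ (b N + ((ecost (cell narr.+1 (Reg 1)) + 1).+1 + 4).+1).+1).
    by rewrite /=; lia.
  have [R0 _ _] := R.
  apply: (steps_seq (bc _ _ _ _ _ tn R0)) => s1 E1.
  have [[h1 h2 h3 h4] h5 h6] := represents_out_exp tn E1 R; have [m1 r1 v1] := E1.
  rewrite /= in h1 h2 h3 h4 h5 h6.
  pose s2 := State (regs s1)
    (update (mem_ s1) (N + 16 * size o + narr.+1) (hev inp A v e)).
  apply: (@steps_seq _ _ _ _ _ (fun s' => s' = s2)).
    by apply: steps_write; rewrite eval_cell /= h1 h5 v1.
  move=> _ ->; apply: steps_assign; split=> /=.
  + split; first split=> //=.
    * by move=> i iN; upd; apply: h3.
    * move=> k i kn; rewrite /update; case: eqP => [H|_]; last exact: h4.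
      by move: kn H; rewrite /narr; lia.
    * by upd; rewrite h5 size_rcons addn1.
    * move=> i; rewrite /= size_rcons nth_rcons ltnS leq_eqVlt.
      case: eqP => [->|ni] /= io; first by rewrite ltnn update_same.
      by rewrite io /narr; upd; apply: h6.
  + by move=> r h7 h8; upd; apply: r1.
  + by rewrite size_rcons; lia.
Qed.

(** Register 0 has to end up with the output length, so the input length, on which all addresses are
    based, is first moved to register [t]. *)
Definition copy_out (t : nat) : cmd :=
  Seq (Seq (Assign t (Reg 0))
  (Seq (Assign 0 (Reg 1))
       (Loop t.+1 (Write (Reg t.+1)
          (Read (Add (Reg t) (Add (twice (twice (twice (twice (Reg t.+1)))))
                                  (Const narr.+1)))))))) Skip.

(** Moving the values in increasing order destroys none that is still to be read: value j sits at
    address N + 16 j + 15, beyond every cell written up to then. *)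
Lemma copy_out_correct inp S v s t :
  1 < t -> represents_out inp S v s ->
  steps (copy_out t) s (100 * size S.2 + 100) (fun s' => output s' = S.2).
Proof.
move=> t1 [[h1 _ _ _] h2 h3]; set N := size inp; set m := size S.2.
apply: (@steps_le _ _ ((2 + (2 + ((60 + 10) * m + 7)).+1).+1 + 1).+1); first lia.
pose P i s' := [/\ regs s' 0 = m, regs s' t = N, regs s' t.+1 = i /\ i <= m,
  forall j, j < i -> mem_ s' j = nth 0 S.2 j
  & forall j, i <= j -> j < m -> mem_ s' (N + 16 * j + 15) = nth 0 S.2 j].
apply: (@steps_seq _ _ _ _ _ (P m)); last first.
  move=> s' [p1 _ _ p3 _]; apply: steps_skip; rewrite /output p1.
  apply: (@eq_from_nth _ 0); first by rewrite size_mkseq.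
  by move=> i; rewrite size_mkseq => im; rewrite nth_mkseq // p3.
apply: (@steps_seq _ _ _ _ _ (fun s' => s' = State (update (regs s) t N) (mem_ s))).
  by apply: steps_assign; rewrite /= h1.
move=> _ ->.
apply: (@steps_seq _ _ _ _ _ (fun s' => s' =
   State (update (update (regs s) t N) 0 m) (mem_ s))).
  by apply: steps_assign; rewrite /=; upd; rewrite h2.
move=> _ ->; apply: steps_loop => //.
- by move=> i s' [p1 p2 [p3 p4] _ _].
- split=> //=; upd=> //.
  by move=> j _ jm; rewrite -h3.
move=> i s' im [p1 p2 [p3 p4] p5 p6].
apply: (@steps_le _ _ (1 + ecost (Read (Add (Reg t)
   (Add (twice (twice (twice (twice (Reg t.+1))))) (Const narr.+1))))).+1).
  by rewrite /=; lia.
apply: steps_write => /=; rewrite p2 p3.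
set a := (X in mem_ s' X).
have -> : mem_ s' a = nth 0 S.2 i.
  by rewrite -p6 //; congr (mem_ _ _); rewrite /a /narr; lia.
split=> /=; upd=> //.
- move=> j ji; rewrite /update; case: eqP => [->//|/eqP jn]; apply: p5; lia.
- by move=> j ji jm; upd; apply: p6 => //; lia.
Qed.

Definition hinit : hstate := ((fun _ _ => 0), [::]).

Theorem compile_correct (c : hcmd) : wf_cmd c ->
  exists (prog : cmd) (k d : nat), forall inp,
    exists2 time, computes prog inp time (hrun inp c (fun=> 0) hinit).2
                & time <= k * (size inp).+1 ^ d.
Proof.
move=> /ccmd_correct [b [bp bc]].
(* Besides running the compiled command, at most [b N] emitted values have to be copied. *)
have [k [d kd]] : poly_bounded (fun N => (b N + (b N + b N * 100)) + 200).
  apply: poly_bounded_add; last exact: poly_bounded_const.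
  apply: poly_bounded_add => //; apply: poly_bounded_add => //.
  have [c0 [d0 H]] := bp; exists (c0 * 100), d0 => N.
  by rewrite mulnAC leq_mul2r H orbT.
(* Any first temporary above the reserved registers 0, ..., 31 would do. *)
exists (Seq (ccmd c 40) (copy_out 40)), k, d => inp.
set S := hrun _ _ _ _; set N := size inp.
(* Memory beyond the input is initially zero, so all arrays start out zero, as in [hinit]. *)
have R0 : represents_out inp hinit (fun=> 0) (init_state inp).
  split=> //; split=> //= i j jn.
  by rewrite nth_default //; lia.
have [|time [s' [H1 H2 H3]]] := @steps_seq (ccmd c 40) (copy_out 40)
    (init_state inp) (b N) (b N * 100 + 100) _ (fun s' => output s' = S.2)
    (bc inp hinit (fun=> 0) (init_state inp) 40 isT R0).
  move=> s' [R1 _ l1].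
  apply: steps_le (copy_out_correct _ R1) => //.
  by move: l1; rewrite -/N -/S /=; lia.
exists time; first by exists s'.
by apply: leq_trans H2 (leq_trans _ (kd N)); lia.
Qed.

(** * Separating residues *)

(* The Leibniz harmonic triangle: 1/c = 1/a - 1/b for a, b, c the denominators
   of the entries (n, k), (n+1, k), (n+1, k+1). *)
Lemma leibniz_triangle_dvd n k W : k <= n ->
  (forall m, 0 < m <= n.+1 -> m %| W) -> n.+1 * 'C(n, k) %| W.
Proof.
elim: k n => [|k IH] n kn WP; first by rewrite bin0 muln1 WP ?leqnn.
case: n kn WP => // n kn WP.
have /dvdnP[p Wp] : n.+1 * 'C(n, k) %| W.
  by apply: IH => // m /andP[m0 mn]; rewrite WP // m0 leqW.
have /dvdnP[q Wq] : n.+2 * 'C(n.+1, k) %| W by apply: IH => //; rewrite ltnW.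
set a := n.+1 * 'C(n, k) in Wp; set b := n.+2 * 'C(n.+1, k) in Wq.
set c := n.+2 * 'C(n.+1, k.+1).
have a0 : 0 < a by rewrite muln_gt0 bin_gt0.
have bl : b * (n.+1 - k) = n.+2 * a.
  by rewrite /b /a -mulnA [_ * (_ - _)]mulnC -mul_bin_down.
have ck : c * k.+1 = n.+2 * a.
  by rewrite /c /a -mulnA [_ * k.+1]mulnC -mul_bin_diag.
have lp : (n.+1 - k) * p = n.+2 * q.
  apply/eqP; rewrite -(eqn_pmul2r a0) -mulnA -Wp Wq mulnCA [_ * b]mulnC bl.
  by rewrite mulnCA mulnA.
have qp : q <= p by rewrite -(leq_pmul2l (ltn0Sn n.+1)) -lp leq_mul2r leq_subLR; lia.
apply/dvdnP; exists (p - q); apply/eqP.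
(* The witness is W/c = W/a - W/b; the identity is checked after multiplication by k+1, so that [ck]
   applies. *)
rewrite -(eqn_pmul2r (ltn0Sn k)) -mulnA ck mulnBl.
have -> : q * (n.+2 * a) = (n.+1 - k) * p * a by rewrite lp; lia.
rewrite [p * _]mulnCA -mulnA -mulnBl -Wp mulnC eqn_mul2r.
by apply/orP; right; lia.
Qed.

(** The n+1 numbers (n+1) C(n, i) divide W, so each is at most W, and they add up to (n+1) 2^n. This
    bounds the least common multiple of 1, ..., n+1 from below. *)
Lemma exp2_le_multiple n W :
  0 < W -> (forall m, 0 < m <= n.+1 -> m %| W) -> 2 ^ n <= W.
Proof.
move=> W0 WP; rewrite -(leq_pmul2l (ltn0Sn n)).
have -> : 2 ^ n = \sum_(i < n.+1) 'C(n, i).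
  rewrite -[2]/(1 + 1) expnDn; apply: eq_bigr => i _.
  by rewrite !exp1n !muln1.
rewrite big_distrr /= -[X in _ <= X * W](card_ord n.+1) -sum_nat_const.
by apply: leq_sum => i _; apply: dvdn_leq => //; apply: leibniz_triangle_dvd => //; rewrite -ltnS.
Qed.

Definition dist (a b : nat) := (a - b) + (b - a).

Lemma dvdn_dist m a b : a = b %[mod m] -> m %| dist a b.
Proof.
move=> ab; have [le|/ltnW le] := leqP a b.
- have -> : dist a b = b - a by rewrite /dist; lia.
  by rewrite -eqn_mod_dvd // ab.
- have -> : dist a b = a - b by rewrite /dist; lia.
  by rewrite -eqn_mod_dvd // ab.
Qed.

(** Let D be the product of the distances from the elements of F to u and to u'. It is positive and
    at most 2^M with M = 2 f lg. If each of 1, ..., M+2 failed, each would divide one of the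
    distances and hence D, and D would be at least 2^(M+1). *)
Lemma good_modulus n f lg (F : {set 'I_n}) (u u' : 'I_n) :
  u \notin F -> u' \notin F -> #|F| <= f -> n <= 2 ^ lg ->
  exists m, [/\ 0 < m, m <= minn n (2 * (f * lg) + 2)
    & forall v, v \in F -> v <> u %[mod m] /\ v <> u' %[mod m]].
Proof.
move=> uF u'F Ff nlg.
have n0 : 0 < n by apply: leq_ltn_trans (ltn_ord u).
have [nM|Mn] := leqP n (2 * (f * lg) + 2).
  (* Modulo n all vertices are distinct. *)
  exists n; split=> // v vF.
  by rewrite !modn_small //; split=> /val_inj E; move: uF u'F; rewrite -E vF.
rewrite addn2; set M := _ * _.
pose D := \prod_(v in F) (dist v u * dist v u').
have D0 : 0 < D.
  apply: prodn_cond_gt0 => v vF; rewrite muln_gt0 /dist.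
  have [vu vu'] : v <> u /\ v <> u' by split=> E; move: uF u'F; rewrite -E vF.
  have : val v <> val u by move/val_inj.
  have : val v <> val u' by move/val_inj.
  by rewrite /=; lia.
have DM : D <= 2 ^ M.
  have H (v w : 'I_n) : dist v w <= 2 ^ lg.
    by apply: leq_trans nlg; have := ltn_ord v; have := ltn_ord w; rewrite /dist; lia.
  apply: leq_trans (_ : \prod_(v in F) 2 ^ (2 * lg) <= _).
    by apply: leq_prod => v _; rewrite mul2n -addnn expnD leq_mul.
  rewrite prod_nat_const -expnM leq_exp2l // /M -mulnA leq_mul2l /=.
  by rewrite mulnC leq_mul2r Ff orbT.
pose good m := [forall v in F, (v != u %[mod m]) && (v != u' %[mod m])].
have [/existsP[m]|/existsPn H] := boolP [exists m : 'I_M.+2, good m.+1].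
  move=> /forall_inP gm; exists m.+1; split=> // v vF.
  by have /andP[/eqP h1 /eqP h2] := gm v vF.
suff : 2 ^ M.+1 <= D by rewrite leqNgt (leq_ltn_trans DM) // ltn_exp2l.
apply: exp2_le_multiple => // m /andP[m0 mM].
have mM' : m.-1 < M.+2 by lia.
have := H (Ordinal mM'); rewrite /good /= prednK // => /forall_inPn[v vF].
rewrite negb_and !negbK => vu.
apply: dvdn_trans (_ : dist v u * dist v u' %| D).
  by case/orP: vu => /eqP /dvdn_dist H1; [apply: dvdn_mulr|apply: dvdn_mull].
by rewrite /D (bigD1 v) //= dvdn_mulr.
Qed.

(** * Hypergraph forests, faults and the spanning forest *)

Section Labels.
Variable T : finType.
Implicit Types (lab : T -> nat) (X : {set T}).

Definition relabel lab (a b : T) : T -> nat :=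
  fun x => if lab x == lab b then lab a else lab x.

(** The potential of both greedy phases: the number of current classes that meet X. Every merge
    lowers it, which pays for the hyperedge or edge that caused the merge. *)
Definition nlab lab X : nat := size (undup [seq lab x | x <- enum X]).

Lemma nlab_le lab X : nlab lab X <= #|X|.
Proof. by rewrite /nlab (leq_trans (size_undup _)) // size_map -cardE. Qed.

Lemma relabel_eq lab a b x y : lab x = lab y -> relabel lab a b x = relabel lab a b y.
Proof. by rewrite /relabel => ->. Qed.

(** The label of b disappears and no new label arises. *)
Lemma nlab_relabel lab X a b :
  a \in X -> b \in X -> lab a != lab b -> nlab (relabel lab a b) X < nlab lab X.
Proof.
move=> aX bX ab; rewrite /nlab.
set s := [seq lab x | x <- _].
have bs : lab b \in undup s by rewrite mem_undup map_f // mem_enum.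
have s0 : 0 < size (undup s) by case: (undup s) bs.
rewrite -(prednK s0) ltnS -(size_rem bs); apply: uniq_leq_size.
  exact: undup_uniq.
move=> y; rewrite mem_undup => /mapP[x]; rewrite mem_enum => xX ->.
rewrite mem_rem_uniq ?undup_uniq // inE mem_undup /relabel.
case: ifP => [_|/negbT ->]; first by rewrite ab map_f // mem_enum.
by rewrite map_f ?mem_enum.
Qed.

Lemma connect_relabel (e e' : rel T) lab a b :
  subrel e e' -> connect_sym e' -> connect e' a b ->
  (forall x y, lab x = lab y -> connect e x y) ->
  forall x y, relabel lab a b x = relabel lab a b y -> connect e' x y.
Proof.
move=> ee' e'sym ab H x y.
have H' z t : lab z = lab t -> connect e' z t.
  move=> /H; apply: connect_sub => u w /ee'; exact: connect1.
rewrite /relabel; case: (eqVneq (lab x)) => [xb|xb]; case: (eqVneq (lab y)) => [yb|yb].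
- by move=> _; apply: H'; rewrite xb.
- move=> ay; apply: connect_trans (H' _ _ xb) (connect_trans _ (H' _ _ ay)).
  by rewrite e'sym.
- move=> xa; apply: connect_trans (H' _ _ xa) (connect_trans ab (H' _ _ _)).
  by rewrite yb.
- exact: H'.
Qed.

End Labels.

(** * Successive edge-disjoint spanning forests of a hypergraph *)

Section Peeling.
Variables (T J : finType) (U : {set T}) (S : J -> {set T}).
Hypothesis SU : forall j, S j \subset U.

(** Every hyperedge is replaced by a clique, so that connectivity in the hypergraph is [connect]. *)
Definition hedge (C : {set J}) : rel T :=
  [rel y z | [exists j in C, (y \in S j) && (z \in S j)]].

Lemma hedge_sym C : connect_sym (hedge C).
Proof.
apply: sym_connect_sym => x y; apply: eq_existsb => j.
by rewrite [(x \in _) && _]andbC.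
Qed.

(** The shift by one leaves the value 0 for hyperedges in no forest. As [used] is a function, the
    forests share no hyperedge. *)
Definition level (used : J -> nat) k : {set J} := [set j | used j == k.+1].

(** Forest k is maximal as far as never chosen hyperedges are concerned: each was available in round
    k, so its vertices must have been connected by the forest. *)
Definition level_done (used : J -> nat) (Jp : {set J}) k : Prop :=
  forall j, j \notin Jp -> forall y z, y \in S j -> z \in S j ->
    connect (hedge (level used k)) y z.

(** A hyperedge of forest k stays available in round k, so that it can merge all of its vertices,
    pair by pair. *)
Definition avail (used : J -> nat) k j := (used j == 0) || (used j == k.+1).

Definition mark (used : J -> nat) k j : J -> nat :=
  fun i => if i == j then k.+1 else used i.

(** Here [c] is the number of marked hyperedges at the start of the round. A new mark always comes
    with a lost label, so by the second clause a forest costs at most |U| marks. *)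
Definition round_inv k c (lab : T -> nat) (used : J -> nat) (Jp : {set J}) : Prop :=
  [/\ forall x y, lab x = lab y -> connect (hedge (level used k)) x y,
      #|Jp| + nlab lab U <= c + #|U|,
      forall j, used j != 0 -> j \in Jp
    & forall k', k' < k -> level_done used Jp k'].

Lemma level_mark_other used k k' j :
  avail used k j -> k' < k -> level (mark used k j) k' = level used k'.
Proof.
move=> av kk; apply/setP => i; rewrite !inE /mark; case: (i =P j) => // ->.
rewrite eqSS [k == k']gtn_eqF //; symmetry.
by case/orP: av => /eqP -> //; rewrite eqSS gtn_eqF.
Qed.

Lemma round_step k c lab used Jp j y z :
  round_inv k c lab used Jp -> avail used k j -> y \in S j -> z \in S j ->
  lab y != lab z ->
  round_inv k c (relabel lab y z) (mark used k j) (j |: Jp).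
Proof.
move=> [h1 h2 h3 h4] av yS zS yz.
have yU := subsetP (SU j) _ yS; have zU := subsetP (SU j) _ zS.
split.
- apply: connect_relabel h1; last 1 first.
  + apply: connect1; apply/existsP; exists j; rewrite inE yS zS /mark !andbT.
    by case: (j =P j).
  + move=> x w /existsP[i /andP[]]; rewrite inE => ik H.
    apply/existsP; exists i; rewrite H andbT inE /mark.
    by case: (i =P j).
  + exact: hedge_sym.
- have := nlab_relabel yU zU yz; rewrite cardsU1.
  by move: h2; case: (j \notin Jp) => /=; lia.
- move=> i; rewrite /mark !inE; case: (i =P j) => //= _; exact: h3.
- move=> k' kk i; rewrite !inE negb_or => /andP[_ iJ] x w xS wS.
  by rewrite level_mark_other //; apply: (h4 k' kk i).
Qed.

End Peeling.

(** * Connectivity off F after dropping the gamma_j outside J *)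

Section Faults.
Variables (T : finType) (G : sgraph T) (J : finType) (gamma : J -> {set T}).
Variables (U : {set T}) (Jp : {set J}).
Hypothesis gamma_disjoint : forall i j, i != j -> [disjoint gamma i & gamma j].
Hypothesis gamma_connected : forall j x y, x \in gamma j -> y \in gamma j ->
  connect [rel a b | [&& a \in gamma j, b \in gamma j & adj G a b]] x y.

Definition touching j : {set T} := [set u in U | [exists w in gamma j, adj G u w]].

Definition kept : {set T} := U :|: \bigcup_(j in Jp) gamma j.

Definition kept_rel (F : {set T}) : rel T :=
  [rel a b | [&& a \in kept, b \in kept, a \notin F, b \notin F & adj G a b]].

Definition covered z := (z \in U) || [exists j, z \in gamma j].

(** The edges that a respecting path off F can use: its one-vertex segments force each vertex to be
    covered, and its two-vertex segments force an edge avoiding U into a single gamma_j. *)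
Definition resp_rel (F : {set T}) : rel T :=
  [rel a b | [&& covered a, covered b, a \notin F, b \notin F, adj G a b &
     [|| a \in U, b \in U | [exists j, (a \in gamma j) && (b \in gamma j)]]]].

Lemma gamma_inj i j x : x \in gamma i -> x \in gamma j -> i = j.
Proof.
move=> xi xj; apply/eqP; apply: contraT => /gamma_disjoint /pred0P /(_ x).
by rewrite /= xi xj.
Qed.

Lemma kept_rel_sym F : connect_sym (kept_rel F).
Proof.
apply: sym_connect_sym => x y; rewrite /kept_rel /= adj_sym.
by case: (x \in F); case: (y \in F); case: (x \in kept); case: (y \in kept).
Qed.

Lemma resp_rel_sym F : connect_sym (resp_rel F).
Proof.
apply: sym_connect_sym => x y; rewrite /resp_rel /= adj_sym.
rewrite (eq_existsb (P2 := fun j => (y \in gamma j) && (x \in gamma j))).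
  by case: (covered x); case: (covered y); case: (x \in F); case: (y \in F);
     case: (x \in U); case: (y \in U).
by move=> j; rewrite andbC.
Qed.

(** A step along hyperedge j becomes a walk from y into gamma_j, through the connected set gamma_j,
    and out to z; all of it is kept and avoids F. *)
Lemma hedge_kept (C : {set J}) (F : {set T}) (S : J -> {set T}) :
  C \subset Jp -> (forall j, j \in C -> [disjoint gamma j & F]) ->
  (forall j, S j \subset touching j) -> (forall j, [disjoint S j & F]) ->
  subrel (connect (hedge S C)) (connect (kept_rel F)).
Proof.
move=> CJ CF SN SF; apply: connect_sub => y z /existsP[j /and3P[jC yS zS]].
have jJ := subsetP CJ _ jC.
have kj w : w \in gamma j -> (w \in kept) && (w \notin F).
  move=> wj; rewrite (disjointFr (CF _ jC) wj) andbT inE; apply/orP; right.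
  by apply/bigcupP; exists j.
have att u : u \in S j -> exists2 w, w \in gamma j & connect (kept_rel F) u w.
  move=> uS; have := subsetP (SN j) _ uS; rewrite inE => /andP[uU /exists_inP[w wj uw]].
  exists w => //; apply: connect1; have /andP[wk wF] := kj w wj.
  by rewrite /kept_rel /= wk wF uw inE uU (disjointFr (SF j) uS).
have [w wj yw] := att y yS; have [w' wj' zw] := att z zS.
apply: connect_trans yw _; apply: connect_trans (_ : connect _ w w') _; last first.
  by rewrite kept_rel_sym.
have := gamma_connected wj wj'; apply: connect_sub => a b /and3P[aj bj ab].
apply: connect1; have /andP[ak aF] := kj a aj; have /andP[bk bF] := kj b bj.
by rewrite /kept_rel /= ak aF bk bF ab.
Qed.

(* The gamma_j meeting F lie on at most |F| levels, so some level is fault free. *)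
Lemma levels_connect f (F : {set T}) (S : J -> {set T}) (used : J -> nat) :
  #|F| <= f -> (forall j, S j \subset touching j) ->
  (forall j, [disjoint S j & F]) -> (forall j, used j != 0 -> j \in Jp) ->
  (forall k, k <= f -> level_done S used Jp k) ->
  forall j, j \notin Jp -> forall y z, y \in S j -> z \in S j ->
  connect (kept_rel F) y z.
Proof.
move=> Ff SN SF uJ done j jJ y z yS zS.
pose hit (k : 'I_f.+1) (x : T) := [exists i in level used k, (x \in gamma i) && (x \in F)].
have [/existsP[k nk]|/existsPn H] := boolP [exists k, ~~ [exists x, hit k x]].
  have := done k (ltn_ord k) j jJ y z yS zS; apply: hedge_kept => //.
    by apply/subsetP => i; rewrite inE => /eqP ik; apply: uJ; rewrite ik.
  move=> i ik; apply/pred0P => x /=; apply/negP => /andP[xi xF].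
  by case/negP: nk; apply/existsP; exists x; apply/existsP; exists i; rewrite ik xi xF.
(* Otherwise pick a fault on each of the f+1 levels. A fault lies in one gamma_i only, and i on one
   level only, so these faults are distinct. *)
have [g gP] : exists g : 'I_f.+1 -> T, forall k, hit k (g k).
  have ex k : exists x, hit k x by apply/existsP; rewrite -[X in is_true X]negbK; apply: H.
  by exists (fun k => xchoose (ex k)) => k; exact: xchooseP.
have ginj : injective g.
  move=> k k' E; have /existsP[i /and3P[ik gi _]] := gP k.
  have /existsP[i' /and3P[ik' gi' _]] := gP k'.
  rewrite E in gi; have ii := gamma_inj gi gi'; subst i'.
  by move: ik ik'; rewrite !inE => /eqP -> /eqP[] /val_inj.
suff : f.+1 <= #|F| by rewrite leqNgt ltnS Ff.
rewrite -[X in X <= _](card_ord f.+1) -(card_imset _ ginj); apply: subset_leq_card.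
by apply/subsetP => x /imsetP[k _ ->]; have /existsP[i /and3P[]] := gP k.
Qed.

(** An edge between a dropped gamma_j and a vertex outside it meets U, so a detour through gamma_j
    enters and leaves by vertices of U touching gamma_j. The hypothesis joins these two vertices
    within the kept part. *)
Lemma resp_kept (F : {set T}) :
  (forall j, j \notin Jp -> forall y z, y \in touching j -> z \in touching j ->
     y \notin F -> z \notin F -> connect (kept_rel F) y z) ->
  forall a b, a \in U -> b \in U -> connect (resp_rel F) a b ->
  connect (kept_rel F) a b.
Proof.
move=> H a b aU bU ab.
(* z is reached, or it lies in a dropped gamma_j touching a reached vertex. *)
pose good z := (z \in kept) && connect (kept_rel F) a z ||
  (z \notin U) && [exists j, [&& j \notin Jp, z \in gamma j &
    [exists u in touching j, (u \notin F) && connect (kept_rel F) a u]]].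
suff : good b.
  by rewrite /good bU /= orbF => /andP[].
have Uk x : x \in U -> x \in kept by move=> xU; rewrite inE xU.
have gk j x : j \in Jp -> x \in gamma j -> x \in kept.
  by move=> jJ xj; rewrite inE; apply/orP; right; apply/bigcupP; exists j.
have ga : good a by rewrite /good Uk //= connect0.
have step x y : good x -> resp_rel F x y -> good y.
  move=> gx /and5P[_ cy xF yF /andP[xy Hxy]].
  case/orP: gx => [/andP[xk ax]|/andP[xU /existsP[j /and3P[jJ xj ex]]]].
  - have [yk|yk] := boolP (y \in kept).
      rewrite /good yk (connect_trans ax) //; apply: connect1.
      by rewrite /kept_rel /= xk yk xF yF xy.
    have yU : y \notin U by apply: contra yk => /Uk.
    rewrite /good (negbTE yk) yU /=.
    have dropped j : y \in gamma j -> j \notin Jp.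
      by move=> yj; apply: contra yk => jJ; apply: gk yj.
    have [xU|xU] := boolP (x \in U).
      move: cy; rewrite /covered (negbTE yU) => /existsP[j yj].
      apply/existsP; exists j; rewrite dropped // yj /=.
      apply/existsP; exists x; rewrite xF ax andbT inE xU /=.
      by rewrite andbT; apply/existsP; exists y; rewrite yj xy.
    move: Hxy; rewrite (negbTE xU) (negbTE yU) => /existsP[j /andP[xj yj]].
    have := dropped j yj; move: xk; rewrite inE (negbTE xU) => /bigcupP[i iJ xi].
    by rewrite -(gamma_inj xi xj) iJ.
  - case/existsP: ex => u /and3P[uj uF au].
    have [yU|yU] := boolP (y \in U).
      rewrite /good Uk // (connect_trans au) //; apply: H jJ _ _ uj _ uF yF.
      by rewrite inE yU; apply/existsP; exists x; rewrite xj adj_sym xy.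
    move: Hxy; rewrite (negbTE xU) (negbTE yU) => /existsP[i /andP[xi yi]].
    rewrite -(gamma_inj xj xi) in yi.
    rewrite /good yU orbC /=; apply/orP; left; apply/existsP; exists j.
    by rewrite jJ yi; apply/existsP; exists u; rewrite uj uF au.
case/connectP: ab => p pp ->.
have walk x : good x -> path (resp_rel F) x p -> good (last x p).
  elim: p x {pp} => //= x p IH y gy /andP[yx xp].
  exact: IH (step _ _ gy yx) xp.
exact: walk ga pp.
Qed.

End Faults.

(** * Kruskal's algorithm with bounded loads *)

Section Forest.
Variables (T : finType) (G : sgraph T) (W : {set T}) (deg0 c L : nat).

(** [load] counts the added edges at a vertex and [deg0] accounts for the initial trees. An accepted
    edge adds 2 to the total load and removes a label, which preserves [forest_total]. *)
Record forest_inv (lab : T -> nat) (E : rel T) (load : T -> nat) : Prop := {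
  forest_edge : forall x y, E x y ->
    [&& x \in W, y \in W, adj G x y & lab x == lab y];
  forest_sym : symmetric E;
  forest_conn : forall x y, x \in W -> y \in W -> lab x = lab y -> connect E x y;
  forest_acyclic : forall p : seq T, ucycle E p -> size p <= 2;
  forest_degree : forall x, #|[set y | E x y]| <= deg0 + load x;
  forest_load : forall x, load x <= L;
  forest_total : \sum_x load x + 2 * nlab lab W <= c
}.

Definition add_edge (E : rel T) (a b : T) : rel T :=
  [rel x y | [|| E x y, (x == a) && (y == b) | (x == b) && (y == a)]].

Definition add_load (load : T -> nat) (a b : T) : T -> nat :=
  fun x => load x + ((x == a) || (x == b)).

Lemma connect_label (E : rel T) (lab : T -> nat) x y :
  (forall x y, E x y -> lab x = lab y) -> connect E x y -> lab x = lab y.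
Proof.
move=> H /connectP[p pp ->]; elim: p x pp => //= z p IH x /andP[/H -> /IH //].
Qed.

(* A cycle of length at least three through a step x -> y that is not in E
   closes an E-path from y to x. *)
Lemma acyclic_add_edge (E : rel T) a b :
  symmetric E -> ~~ connect E a b ->
  (forall p : seq T, ucycle E p -> size p <= 2) ->
  forall p : seq T, ucycle (add_edge E a b) p -> size p <= 2.
Proof.
move=> Esym nab acyc p /andP[cp up]; rewrite leqNgt; apply/negP => p3.
have [/allP H|/allPn[x xp nE]] := boolP (all (fun x => E x (next p x)) p).
  have := acyc p; rewrite /ucycle up andbT (cycle_from_next up) // => /(_ isT).
  by rewrite leqNgt p3.
have [i q pq] := rot_to xp.
have uq : uniq (x :: q) by rewrite -pq rot_uniq.
have cq : cycle (add_edge E a b) (x :: q) by rewrite -pq rot_cycle.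
have sq : size (x :: q) > 2 by rewrite -pq size_rot.
move: nE; rewrite -(next_rot i up) pq.
case: q uq cq sq {pq} => [|y [|z q]] // uq.
rewrite [next _ _]/= eqxx => /= /and3P[Exy Eyz pz] _ nE.
have {}Exy : (x == a) && (y == b) || (x == b) && (y == a).
  by move: Exy; rewrite /add_edge /= (negbTE nE).
have /and5P[xn yn zn _ _] : [&& x \notin [:: y, z & q], y \notin z :: q, z \notin q,
   uniq q & true] by move: uq => /= /and4P[-> -> -> ->].
(* The new edge joins x and y, so every step of the cycle other than x -> y is an old edge. *)
have keep u w : add_edge E a b u w -> u != x -> w != x -> E u w.
  move=> /= /or3P[//|/andP[/eqP h1 /eqP h2]|/andP[/eqP h1 /eqP h2]] /eqP ? /eqP ?;
  by exfalso; case/orP: Exy => /andP[/eqP ? /eqP ?]; congruence.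
have keepx u : add_edge E a b u x -> u != x -> u != y -> E u x.
  move=> /= /or3P[//|/andP[/eqP h1 /eqP h2]|/andP[/eqP h1 /eqP h2]] /eqP ? /eqP ?;
  by exfalso; case/orP: Exy => /andP[/eqP ? /eqP ?]; congruence.
suff yx : connect E y x.
  have : connect E a b.
    case/orP: Exy => /andP[/eqP <- /eqP <-] //.
    by rewrite (sym_connect_sym Esym).
  by rewrite (negbTE nab).
have yx : y != x by apply: contraNneq xn => ->; rewrite inE eqxx.
have zx : z != x by apply: contraNneq xn => ->; rewrite !inE eqxx orbT.
have zy : z != y by apply: contraNneq yn => ->; rewrite inE eqxx.
have {xn}xq : x \notin q by apply: contra xn => H; rewrite !inE H !orbT.
have {yn}yq : y \notin q by apply: contra yn => H; rewrite !inE H !orbT.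
apply: connect_trans (connect1 (keep _ _ Eyz yx zx)) _.
move: pz xq yq; elim: q {uq zn Eyz} z zx zy => [|w q IH] z zx zy /=.
  by rewrite andbT => zx' _ _; apply/connect1/keepx.
move=> /andP[zw pw]; rewrite !inE !negb_or ![_ == w]eq_sym.
move=> /andP[wx xq] /andP[wy yq].
exact: connect_trans (connect1 (keep _ _ zw zx wx)) (IH _ wx wy pw xq yq).
Qed.

Lemma forest_step lab E load a b :
  forest_inv lab E load -> a \in W -> b \in W -> adj G a b -> lab a != lab b ->
  load a < L -> load b < L ->
  forest_inv (relabel lab a b) (add_edge E a b) (add_load load a b).
Proof.
move=> I aW bW ab lab_ab La Lb.
have Elab x y : E x y -> lab x = lab y by move=> /(forest_edge I) /and4P[_ _ _ /eqP].
have nab : a != b by apply: contraNneq lab_ab => ->.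
have E'sym : symmetric (add_edge E a b).
  move=> x y; rewrite /add_edge /= (forest_sym I) [(x == a) && _]andbC [(x == b) && _]andbC.
  by congr (_ || _); rewrite orbC.
have lab'ab : relabel lab a b a = relabel lab a b b.
  by rewrite /relabel eqxx (negbTE lab_ab).
split=> //.
- move=> x y /= /or3P[xy|/andP[/eqP -> /eqP ->]|/andP[/eqP -> /eqP ->]].
  + have /and4P[-> -> -> _] := forest_edge I xy.
    by rewrite (relabel_eq _ _ (Elab _ _ xy)) eqxx.
  + by rewrite aW bW ab lab'ab eqxx.
  + by rewrite aW bW adj_sym ab lab'ab eqxx.
- have sub : subrel (connect E) (connect (add_edge E a b)).
    by apply: connect_sub => x y xy; apply: connect1; rewrite /add_edge /= xy.
  have cab : connect (add_edge E a b) a b by apply: connect1; rewrite /add_edge /= !eqxx orbT.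
  have csym := sym_connect_sym E'sym.
  have H x y : x \in W -> y \in W -> lab x = lab y -> connect (add_edge E a b) x y.
    by move=> xW yW /(forest_conn I xW yW) /sub.
  move=> x y xW yW; rewrite /relabel.
  case: (eqVneq (lab x)) => [xb|xb]; case: (eqVneq (lab y)) => [yb|yb].
  + by move=> _; apply: H; rewrite ?xb.
  + move=> ay; apply: connect_trans (H _ _ xW bW xb) _.
    by rewrite csym in cab; apply: connect_trans cab (H _ _ aW yW ay).
  + move=> xa; apply: connect_trans (H _ _ xW aW xa) (connect_trans cab _).
    by apply: H.
  + exact: H.
- apply: acyclic_add_edge (forest_sym I) _ (forest_acyclic I).
  by apply: contra lab_ab => /(connect_label Elab) ->.
- move=> x; have := forest_degree I x; rewrite /add_load.
  have [->|xa] := eqVneq x a.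
    move=> le; apply: leq_trans (_ : #|b |: [set y | E a y]| <= _).
      apply: subset_leq_card; apply/subsetP => y; rewrite !inE /add_edge /=.
      by rewrite eqxx (negbTE nab) /= orbF orbC.
    by rewrite cardsU1; case: (_ \notin _); lia.
  have [->|xb] := eqVneq x b.
    move=> le; apply: leq_trans (_ : #|a |: [set y | E b y]| <= _).
      apply: subset_leq_card; apply/subsetP => y; rewrite !inE /add_edge /=.
      by rewrite [b == a]eq_sym (negbTE nab) eqxx /= orbC.
    by rewrite cardsU1; case: (_ \notin _); lia.
  rewrite addn0 => le; apply: leq_trans le; apply: subset_leq_card.
  by apply/subsetP => y; rewrite !inE /add_edge /= (negbTE xa) (negbTE xb) !orbF.
- move=> x; rewrite /add_load; have := forest_load I x.
  have [->|xa] := eqVneq x a; first lia.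
  by have [->|xb] := eqVneq x b; lia.
- have := nlab_relabel aW bW lab_ab; have := forest_total I; rewrite /add_load.
  rewrite big_split /=.
  have -> : \sum_x ((x == a) || (x == b) : nat) = 2.
    rewrite (bigD1 a) //= eqxx (bigD1 b) /= ?eqxx ?orbT 1?eq_sym //.
    by rewrite big1 // => x /andP[/negbTE -> /negbTE ->].
  by lia.
Qed.

End Forest.

Section InitialForest.
Variables (T : finType) (G : sgraph T) (D : decomposition G) (Jp : {set 'I_(dsize D)}).
Let W := kept (@dgamma _ _ D) (dU D) Jp.

Definition tree_rel : rel T := [rel x y | [exists j in Jp, adj (dtree j) x y]].

Lemma dtree_sub j x y : adj (dtree (d:=D) j) x y ->
  [&& x \in dgamma j, y \in dgamma j & adj G x y].
Proof. by have [H _ _] := dtree_spanning j; apply: H. Qed.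

Lemma tree_rel_dtree j x y : x \in dgamma j -> tree_rel x y -> adj (dtree (d:=D) j) x y.
Proof.
move=> xj /existsP[i /andP[_ xy]]; have /and3P[xi _ _] := dtree_sub xy.
by rewrite (gamma_inj (@dgamma_disjoint _ _ D) xj xi).
Qed.

(** The budget is twice the number of initial labels: each label on W belongs to a vertex of U or to
    a kept gamma_j. Tree edges are charged to the degree of D, so loads start at zero. *)
Lemma forest_init (lab : T -> nat) (L : nat) :
  (forall j x y, j \in Jp -> x \in dgamma j -> y \in dgamma j -> lab x = lab y) ->
  (forall x y, x \in W -> y \in W -> lab x = lab y ->
     x = y \/ exists2 j, j \in Jp & (x \in dgamma j) && (y \in dgamma j)) ->
  forest_inv G W (decomp_degree D) (2 * (#|dU D| + #|Jp|)) L lab tree_rel (fun=> 0).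
Proof.
move=> lab1 lab2; split=> //.
- move=> x y /existsP[j /andP[jJ xy]]; have /and3P[xj yj axy] := dtree_sub xy.
  rewrite axy (lab1 j x y) // eqxx !inE.
  by apply/and4P; split=> //; apply/orP; right; apply/bigcupP; exists j.
- by move=> x y; apply: eq_existsb => j; rewrite adj_sym.
- move=> x y xW yW /(lab2 _ _ xW yW) [->|[j jJ /andP[xj yj]]]; first exact: connect0.
  have [_ H _] := dtree_spanning j; apply: connect_sub (H x y xj yj) => a b ab.
  by apply: connect1; apply/existsP; exists j; rewrite jJ.
(* By disjointness a cycle never leaves the tree in which it starts. *)
- move=> [|x p] // /andP[cp up].
  have [j xj] : exists j, x \in dgamma (d:=D) j.
    have : exists y, tree_rel x y.
      by move: cp; case: p {up} => [|y p] /= /andP[xy _]; [exists x|exists y].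
    by case=> y /existsP[j /andP[_ /dtree_sub /and3P[xj _ _]]]; exists j.
  have [_ _ acyc] := dtree_spanning j; apply: acyc; rewrite /ucycle up andbT.
  have walk q z : z \in dgamma j -> path tree_rel z q -> path (adj (dtree j)) z q.
    elim: q z => //= y q IH z zj /andP[/(tree_rel_dtree zj) zy].
    by rewrite zy /=; apply: IH; have /and3P[] := dtree_sub zy.
  exact: walk xj cp.
- move=> x; rewrite addn0.
  have [/existsP[j xj]|/existsPn nx] := boolP [exists j, x \in dgamma (d:=D) j].
    apply: leq_trans (_ : #|[set y | adj (dtree j) x y]| <= _).
      apply: subset_leq_card; apply/subsetP => y; rewrite !inE; exact: tree_rel_dtree.
    apply: leq_trans (leq_bigmax j); exact: (leq_bigmax x).
  rewrite (_ : [set _ | _] = set0) ?cards0 //; apply/setP => y; rewrite !inE.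
  apply/existsP => -[j /andP[_ /dtree_sub /and3P[xj _ _]]].
  by move: (nx j); rewrite xj.
- rewrite big1 // add0n leq_mul2l /=.
  (* The common label of gamma_j; the value 0 for an empty gamma_j is a mere default. *)
  pose f j := if [pick x in dgamma (d:=D) j] is Some x then lab x else 0.
  have -> : #|dU D| + #|Jp| =
      size ([seq lab x | x <- enum (dU D)] ++ [seq f j | j <- enum Jp]).
    by rewrite size_cat !size_map -!cardE.
  apply: uniq_leq_size; first exact: undup_uniq.
  move=> y; rewrite mem_undup mem_cat => /mapP[x]; rewrite mem_enum inE.
  move=> /orP[xU|/bigcupP[j jJ xj]] ->; first by rewrite map_f ?mem_enum.
  apply/orP; right; apply/mapP; exists j; rewrite ?mem_enum // /f.
  by case: pickP => [z zj|/(_ x)]; [exact: lab1 zj|rewrite xj].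
Qed.

End InitialForest.

(** * The decomposition given by the final forest *)

Section Build.
Variables (n : nat) (G : sgraph 'I_n) (W : {set 'I_n}) (deg0 c L : nat).
Variables (lab : 'I_n -> nat) (E : rel 'I_n) (load : 'I_n -> nat).
Hypothesis I : forest_inv G W deg0 c L lab E load.

Definition part_adj (i : 'I_n) : rel 'I_n :=
  [rel x y | [&& E x y, lab x == i & lab y == i]].

Lemma part_adj_sym i : symmetric (part_adj i).
Proof. by move=> x y; rewrite /part_adj /= (forest_sym I) [(_ == _) && _]andbC. Qed.

Lemma part_adj_irr i : irreflexive (part_adj i).
Proof.
move=> x; apply/negP => /andP[/(forest_edge I) /and4P[_ _]].
by rewrite adj_irr.
Qed.

(** Components are indexed by their labels, which will be below n. This gives exactly n parts, some
    possibly empty, and avoids renumbering in the program. *)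
Definition part (i : 'I_n) : {set 'I_n} := [set x in W | lab x == i].

Definition part_tree (i : 'I_n) : sgraph 'I_n :=
  SGraph (@part_adj_sym i) (@part_adj_irr i).

Lemma part_disjoint i j : i != j -> [disjoint part i & part j].
Proof.
move=> ij; apply/pred0P => x /=; rewrite !inE; apply: contraNF ij.
by move=> /andP[/andP[_ /eqP xi] /andP[_ /eqP xj]]; apply/eqP/val_inj; rewrite /= -xi -xj.
Qed.

Lemma part_spanning i : spanning_tree G (part i) (part_tree i).
Proof.
split.
- move=> x y /= /and3P[/(forest_edge I) /and4P[xW yW xy _] xi yi].
  by rewrite !inE xW yW xi yi xy.
- move=> x y; rewrite !inE => /andP[xW /eqP xi] /andP[yW /eqP yi].
  have : connect E x y by apply: forest_conn I _ _ xW yW _; rewrite xi yi.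
  case/connectP=> p pp ->; apply/connectP; exists p => //.
  elim: p x xi pp {xW yW y yi} => //= y p IH x xi /andP[xy pp].
  have /and4P[_ _ _ /eqP xyl] := forest_edge I xy.
  by rewrite /part_adj /= xy -xyl xi eqxx IH // -xyl.
- move=> p /andP[cp up]; apply: (forest_acyclic I); rewrite /ucycle up andbT.
  by apply: sub_cycle cp => x y /and3P[].
Qed.

Definition parts_decomposition (B : {set 'I_n}) : decomposition G :=
  Decomposition B part_disjoint part_spanning.

Lemma parts_degree B : decomp_degree (parts_decomposition B) <= deg0 + L.
Proof.
apply/bigmax_leqP => i _; apply/bigmax_leqP => x _.
apply: leq_trans (leq_trans (forest_degree I x) _).
  by apply: subset_leq_card; apply/subsetP => y; rewrite !inE => /and3P[].
by rewrite leq_add2l (forest_load I).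
Qed.

(** Along a segment without vertices of B, consecutive vertices have equal labels by [cross], so the
    segment stays in one part. The walk is shortened first because paths are simple. *)
Lemma parts_respects (B F : {set 'I_n}) a b :
  (forall x, lab x < n) ->
  (forall x y, x \in W -> y \in W -> adj G x y ->
     [|| x \in B, y \in B | lab x == lab y]) ->
  a \in W -> a \notin F ->
  connect [rel x y | [&& x \in W, y \in W, x \notin F, y \notin F & adj G x y]] a b ->
  triplet_respects (parts_decomposition B) a b F.
Proof.
move=> labn cross aW aF /connectP[p0 pp0 ->].
have [p pp up _] := shortenP pp0.
have [padj pall] : path (adj G) a p /\ all (fun x => (x \in W) && (x \notin F)) (a :: p).
  split; first by apply: sub_path pp => x y /and5P[].
  rewrite /= aW aF /=; elim: p a {up aW aF pp0} pp => //= y p IH a.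
  by move=> /andP[/and5P[_ -> _ -> _]] /=; apply: IH.
have pathF : path [rel x y | [&& x \in ~: F, y \in ~: F & adj G x y]] a p.
  by apply: sub_path pp => x y /and5P[_ _ xF yF xy]; rewrite /= !inE xF yF xy.
right; split.
  have := allP pall _ (mem_last a p) => /andP[_ lF].
  by rewrite /connected_in !inE aF lF /=; apply/connectP; exists p.
exists p; split.
  apply/and4P; split=> //; apply: sub_all pall => x /andP[_].
  by rewrite /= inE.
move=> [|z q] // _ /infixP[s1 [s2 eqp]] qB.
have zq x : x \in z :: q -> x \in W.
  move=> xq; have /allP/(_ x) := pall; rewrite eqp !mem_cat xq orbT => /(_ isT).
  by case/andP.
have pq : path (adj G) z q.
  have : sorted (adj G) (a :: p) by [].
  by rewrite eqp => /cat_sorted2[_ /cat_sorted2[]].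
exists (Ordinal (labn z)) => x xq; rewrite inE zq //=.
move: x xq; elim: q z zq qB pq {eqp} => [|y q IH] z zq qB /=.
  by move=> _ x; rewrite inE => /eqP ->.
move=> /andP[zy pq] x; rewrite inE => /orP[/eqP -> //|xq].
have := cross z y (zq z _) (zq y _) zy; rewrite !inE !eqxx orbT => /(_ isT isT).
rewrite (negbTE (qB z _)) ?(negbTE (qB y _)) ?inE ?eqxx ?orbT //= => /eqP ->.
apply: IH => // w wq; [apply: zq|apply: qB]; by rewrite inE wq orbT.
Qed.

End Build.

(** Q' collects the triplets (a, b, F) with a in U(s, F) and b in U(t, F) for some (s, t, F) in Q.
    By definition of U(s, F), [resp_rel] joins a to s and b to t, and a respecting s-t path consists
    of [resp_rel] edges. If s and t are not F-connected, neither are a and b. *)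
Lemma respecting_transfer (T : finType) (G : sgraph T) (D D' : decomposition G) f :
  (forall (F : {set T}) a b, #|F| <= f -> a \in dU D -> b \in dU D -> a \notin F ->
     connect (resp_rel G (@dgamma _ _ D) (dU D) F) a b ->
     triplet_respects D' a b F) ->
  forall Q : {set T * T * {set T}}, respecting f D Q ->
  exists Q' : {set T * T * {set T}}, respecting f D' Q' /\
    (forall s t (F : {set T}), (s, t, F) \in Q -> forall a b, a \in Uset D s F ->
       b \in Uset D t F -> (a, b, F) \in Q').
Proof.
move=> H Q RQ.
exists [set q | [exists p in Q, [&& p.2 == q.2, q.1.1 \in Uset D p.1.1 p.2 &
                                    q.1.2 \in Uset D p.1.2 p.2]]].
split; last first.
  move=> s t F stF a b aU bU; rewrite inE; apply/existsP; exists (s, t, F).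
  by rewrite stF eqxx aU bU.
move=> a b F; rewrite inE => /existsP[[[s t] F'] /= /and4P[stF /eqP FF]]; subst F'.
move=> aU bU; have [Ff sF tF R] := RQ _ _ _ stF.
set rel := resp_rel G (@dgamma _ _ D) (dU D) F.
have gcov j x : x \in dgamma (d:=D) j -> covered (@dgamma _ _ D) (dU D) x.
  by move=> xj; apply/orP; right; apply/existsP; exists j.
have Ucov x : x \in dU D -> covered (@dgamma _ _ D) (dU D) x.
  by move=> xU; rewrite /covered xU.
(* From x, one edge at most leads to the component of y in gamma_j off F; it is a [resp_rel] edge
   because x is in U. *)
have U1 x y : y \notin F -> x \in Uset D y F ->
    [/\ x \in dU D, x \notin F & connect rel x y].
  move=> yF; rewrite /Uset; case: pickP => [j yj|_].
    rewrite !inE => /andP[/andP[xF xU] /set0Pn[w]]; rewrite !inE.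
    move=> /andP[xw yw]; split=> //.
    have [_ wj cyw] := and3P yw.
    have xwc : connect rel x w.
      case/orP: xw => [/eqP -> //|xw]; apply: connect1.
      have wF : w \notin F by move: wj; rewrite inE => /andP[].
      have wj' : w \in dgamma j by move: wj; rewrite inE => /andP[].
      by rewrite /rel /resp_rel /= Ucov // (gcov j) // xF wF xw xU.
    apply: connect_trans xwc _; rewrite (resp_rel_sym G _ _ F).
    apply: connect_sub cyw => u v /= /and3P[]; rewrite !inE => /andP[uF uj] /andP[vF vj] uv.
    apply: connect1; rewrite /rel /resp_rel /= (gcov j u) // (gcov j v) // uF vF uv /=.
    by apply/or3P; apply: Or33; apply/existsP; exists j; rewrite uj vj.
  case: ifP => [yU|]; last by rewrite inE.
  by rewrite inE => /eqP ->.
have [aD aF as_] := U1 a s sF aU; have [bD bF bt] := U1 b t tF bU.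
split=> //.
have GF : subrel (connect rel)
    (connect [rel x y | [&& x \in ~: F, y \in ~: F & adj G x y]]).
  apply: connect_sub => x y /and5P[_ _ xF yF /andP[xy _]]; apply: connect1.
  by rewrite /= !inE xF yF xy.
have GFsym : connect_sym [rel x y | [&& x \in ~: F, y \in ~: F & adj G x y]].
  by apply: sym_connect_sym => x y; rewrite /= adj_sym !inE; case: (x \in F); case: (y \in F).
case: R => [nst|[_ [p [/and4P[pp _ /eqP lp pF] pr]]]].
  left; apply: contra nst => /and3P[_ _ ab]; rewrite /connected_in !inE sF tF /=.
  apply: connect_trans (GF _ _ bt); apply: connect_trans ab.
  by rewrite GFsym; apply: GF.
apply: H => //; apply: connect_trans as_ _.
rewrite (resp_rel_sym G _ _ F) in bt; apply: connect_trans _ bt.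
apply/connectP; exists p => //.
have cov x : x \in s :: p -> covered (@dgamma _ _ D) (dU D) x.
  move=> xp; have [xU|xU] := boolP (x \in dU D); first exact: Ucov.
  have [//|||j jP] := pr [:: x]; first by rewrite infix1s.
    by move=> y; rewrite inE => /eqP ->.
  by apply: (gcov j); apply: jP; rewrite inE.
have walk q x : path (adj G) x q -> path_respects D (x :: q) ->
    all (mem (~: F)) (x :: q) ->
    (forall y, y \in x :: q -> covered (@dgamma _ _ D) (dU D) y) -> path rel x q.
  elim: q x => //= y q IH x /andP[xy pq] prq /and3P[xF yF qF] covq.
  rewrite !inE in xF yF; apply/andP; split; last first.
    apply: IH => //=.
    - move=> r r0 rq; apply: prq => //; apply: infix_trans rq _.
      by apply/infixP; exists [:: x], [::]; rewrite cats0.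
    - by rewrite inE yF.
    - by move=> z zq; apply: covq; rewrite inE zq orbT.
  rewrite /rel /resp_rel /= !covq ?inE ?eqxx ?orbT // xF yF xy /=.
  have [//|xU] := boolP (x \in dU D); have [//|yU] := boolP (y \in dU D).
  have [//|||j jP] := prq [:: x; y].
  - by apply/infixP; exists [::], q.
  - by move=> z; rewrite !inE => /orP[] /eqP ->.
  by apply/existsP; exists j; rewrite !jP // !inE eqxx ?orbT.
exact: walk pp pr pF cov.
Qed.

(** * The algorithm as an array program *)

Definition hlt a b := HIte (HSub b a) (HC 1) (HC 0).
Definition hne a b := HAdd (HSub a b) (HSub b a).
Definition heq a b := HIte (hne a b) (HC 0) (HC 1).
Definition hand a b := HIte a (HIte b (HC 1) (HC 0)) (HC 0).
Definition hor a b := HIte a (HC 1) (HIte b (HC 1) (HC 0)).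
Definition hex r e := HIte (HSum r e) (HC 1) (HC 0).
(** Multiplication as repeated addition: [b] is summed over the i < N with i < [a], which is the
    product as long as [a] is at most N. *)
Definition hmul r a b := HSum r (HIte (hlt (HV r) a) b (HC 0)).
Definition hmin a b := HSub a (HSub a b).
(** The bound is evaluated anew in each round, so the loop rules ask that the body leave its value
    unchanged. The rounds executed are those below min(e, N). *)
Definition hforlt r e c := HFor r (HIf (hlt (HV r) e) c).

Lemma nat_of_bool_neq0 (b : bool) : (nat_of_bool b != 0) = b.
Proof. by case: b. Qed.

(** * Evaluation and loop rules for array programs *)

Section Evaluation.
Variable inp : seq nat.
Let N := size inp.
Implicit Types (A : nat -> nat -> nat) (v : nat -> nat).

Lemma hev_In A v e : hev inp A v (HIn e) = nth 0 inp (hev inp A v e).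
Proof. by []. Qed.

Lemma hev_Add A v a b : hev inp A v (HAdd a b) = hev inp A v a + hev inp A v b.
Proof. by []. Qed.

Lemma hev_C A v c : hev inp A v (HC c) = c. Proof. by []. Qed.

Lemma hev_V A v r : hev inp A v (HV r) = v r. Proof. by []. Qed.

Lemma hev_A A v k e : hev inp A v (HA k e) = A k (hev inp A v e). Proof. by []. Qed.

Lemma hev_Ite A v e1 e2 e3 : hev inp A v (HIte e1 e2 e3) =
  if hev inp A v e1 != 0 then hev inp A v e2 else hev inp A v e3.
Proof. by []. Qed.

Lemma hev_Sum A v r e :
  hev inp A v (HSum r e) = \sum_(0 <= i < N) hev inp A (update v r i) e.
Proof. by []. Qed.

Definition hevE := (hev_In, hev_Add, hev_C, hev_V, hev_A, hev_Ite).

Lemma hev_lt A v a b : hev inp A v (hlt a b) = (hev inp A v a < hev inp A v b).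
Proof. by rewrite /= subn_eq0 -ltnNge; case: ltnP. Qed.

Lemma hev_ne A v a b : (hev inp A v (hne a b) != 0) = (hev inp A v a != hev inp A v b).
Proof. by rewrite /=; lia. Qed.

Lemma hev_eq A v a b : hev inp A v (heq a b) = (hev inp A v a == hev inp A v b).
Proof.
rewrite /heq; have := hev_ne A v a b; rewrite [hev _ _ _ (HIte _ _ _)]/= => ->.
by case: eqP.
Qed.

Lemma hev_and A v a b :
  hev inp A v (hand a b) = (hev inp A v a != 0) && (hev inp A v b != 0).
Proof. by rewrite /=; case: eqP => //; case: eqP. Qed.

Lemma hev_or A v a b :
  hev inp A v (hor a b) = (hev inp A v a != 0) || (hev inp A v b != 0).
Proof. by rewrite /=; case: eqP => //; case: eqP. Qed.

Lemma hev_ex A v r e :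
  hev inp A v (hex r e) = has (fun i => hev inp A (update v r i) e != 0) (iota 0 N).
Proof.
rewrite /= -/N /index_iota subn0 sum_nat_seq_neq0.
by rewrite (@eq_has _ _ (fun i => hev inp A (update v r i) e != 0)) //; case: has.
Qed.

Lemma sum_ltn m : \sum_(0 <= i < N) (i < m) = minn m N.
Proof.
elim: N => [|M IH]; first by rewrite big_geq // minn0.
by rewrite big_nat_recr //= IH; lia.
Qed.

Lemma hev_mul A v r e1 e2 a b :
  (forall i, hev inp A (update v r i) e1 = a) ->
  (forall i, hev inp A (update v r i) e2 = b) -> a <= N ->
  hev inp A v (hmul r e1 e2) = a * b.
Proof.
move=> e1a e2b aN; rewrite /hmul [LHS]/= -/N.
rewrite (eq_bigr (fun i => (i < a) * b)) => [|i _]; last first.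
  have := hev_lt A (update v r i) (HV r) e1; rewrite /= e1a e2b update_same => ->.
  by case: (i < a); rewrite ?mul1n ?mul0n.
by rewrite -big_distrl /= sum_ltn (minn_idPl aN).
Qed.

Lemma hev_min A v a b : hev inp A v (hmin a b) = minn (hev inp A v a) (hev inp A v b).
Proof. by rewrite /= minnE. Qed.

Lemma hrun_for r c v (P : nat -> hstate -> Prop) S :
  P 0 S -> (forall i S', i < N -> P i S' -> P i.+1 (hrun inp c (update v r i) S')) ->
  P N (hrun inp (HFor r c) v S).
Proof.
move=> P0 PS /=; rewrite -/N.
have : forall m, m <= N -> P m (foldl (fun S i => hrun inp c (update v r i) S) S (iota 0 m)).
  elim=> [//|m IH] mN; rewrite -addn1 iotaD foldl_cat add0n /= addn1.
  by apply: PS => //; apply: IH; apply: ltnW.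
exact.
Qed.

Lemma hrun_forlt r e c v bn (P : nat -> hstate -> Prop) S :
  (forall i S', P i S' -> forall w, hev inp S'.1 w e = bn) ->
  P 0 S ->
  (forall i S', i < minn bn N -> P i S' -> P i.+1 (hrun inp c (update v r i) S')) ->
  P (minn bn N) (hrun inp (hforlt r e c) v S).
Proof.
move=> Pe P0 PS.
apply: (hrun_for (P := fun i S => P (minn bn i) S)); first by rewrite minn0.
move=> i S' iN Pi /=.
rewrite (Pe _ _ Pi) update_same subn_eq0 -ltnNge; case: ltnP => ib /=.
  rewrite (_ : minn bn i.+1 = i.+1); last lia.
  apply: PS; first lia.
  by rewrite (_ : minn bn i = i) in Pi; last lia.
by rewrite (_ : minn bn i.+1 = minn bn i) //; lia.
Qed.

Section Specifications.
Variables (Inv : hstate -> Prop) (R : nat -> hstate -> hstate -> Prop).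
Hypothesis R_refl : forall S, R 0 S S.
Hypothesis R_trans : forall a b S S' S'', R a S S' -> R b S' S'' -> R (a + b) S S''.

(** [R] describes monotone progress, graded by a cost that adds up along loops. A goal [Q] reached
    in one round persists through the later ones if it is stable under [R]. *)
Definition hspec c v cost (Q : hstate -> Prop) : Prop :=
  forall S, Inv S -> [/\ Inv (hrun inp c v S), R cost S (hrun inp c v S)
                       & Q (hrun inp c v S)].

Lemma hspec_forlt r e c v bn cost (Q : nat -> hstate -> Prop) :
  (forall S w, Inv S -> hev inp S.1 w e = bn) ->
  (forall i k S S', R k S S' -> Q i S -> Q i S') ->
  (forall i, i < minn bn N -> hspec c (update v r i) cost (Q i)) ->
  hspec (hforlt r e c) v (minn bn N * cost) (fun S => forall i, i < minn bn N -> Q i S).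
Proof.
move=> He HQ Hc S IS.
pose P i S' := [/\ Inv S', R (i * cost) S S' & forall i', i' < i -> Q i' S'].
have : P (minn bn N) (hrun inp (hforlt r e c) v S).
  apply: hrun_forlt.
  - by move=> i S' [I' _ _] w; apply: He.
  - by split=> //; rewrite mul0n.
  move=> i S' ib [I' R' Q']; have [I'' R'' Q''] := Hc i ib S' I'.
  split=> //; first by rewrite mulSn addnC; apply: R_trans R' R''.
  move=> i'; rewrite ltnS leq_eqVlt => /orP[/eqP -> //|ii].
  exact: HQ R'' (Q' _ ii).
by case.
Qed.

End Specifications.

Definition emits c v A (l : seq nat) : Prop :=
  forall o, hrun inp c v (A, o) = (A, o ++ l).

Lemma emits_emit e v A : emits (HEmit e) v A [:: hev inp A v e].
Proof. by move=> o /=; rewrite cats1. Qed.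

Lemma emits_seq c1 c2 v A l1 l2 :
  emits c1 v A l1 -> emits c2 v A l2 -> emits (HSeq c1 c2) v A (l1 ++ l2).
Proof. by move=> H1 H2 o /=; rewrite H1 H2 catA. Qed.

Lemma emits_forlt r e c v A n (l : 'I_n -> seq nat) :
  n <= N -> (forall w, hev inp A w e = n) ->
  (forall x : 'I_n, emits c (update v r x) A (l x)) ->
  emits (hforlt r e c) v A (flatten [seq l x | x <- enum 'I_n]).
Proof.
move=> nN He Hc o.
pose l' i := if insub i is Some x then l x else [::].
have -> : flatten [seq l x | x <- enum 'I_n] = flatten [seq l' i | i <- iota 0 n].
  congr flatten; rewrite -val_enum_ord -map_comp; apply: eq_map => x /=.
  by rewrite /l' valK.
pose P i S := S = (A, o ++ flatten [seq l' x | x <- iota 0 i]).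
have : P (minn n N) (hrun inp (hforlt r e c) v (A, o)).
  apply: hrun_forlt => [i S -> //||i S im ->]; first by rewrite /P /= cats0.
  have im' : i < n by lia.
  rewrite (Hc (Ordinal im')) /P -addn1 iotaD map_cat flatten_cat catA /= add0n cats0.
  by rewrite /l' insubT.
by rewrite (minn_idPl nN).
Qed.

End Evaluation.

Lemma nth_flatten_blocks B (ss : seq (seq nat)) s j i :
  all (fun t => size t == B) ss -> j < size ss -> i < B ->
  nth 0 (flatten ss ++ s) (j * B + i) = nth 0 (nth [::] ss j) i.
Proof.
elim: ss j => //= t ss IH j /andP[/eqP tB ssB] js iB.
rewrite -catA nth_cat tB; case: j js => [|j] js; first by rewrite mul0n add0n iB.
rewrite ifF; last by rewrite mulSn; lia.
by rewrite mulSn -addnA addKn IH.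
Qed.

(** * Reading graph and decomposition from the encoded input *)

Section InputLayout.
Variables (n : nat) (G : sgraph 'I_n) (f tau : nat) (D : decomposition G).
Let inp := enc_input f D tau.
Let N := size inp.
Let d := dsize D.

Lemma size_enc_set (A : {set 'I_n}) : size (enc_set A) = n.
Proof. by rewrite size_map size_enum_ord. Qed.

Lemma nth_enc_set (A : {set 'I_n}) (x : 'I_n) s : nth 0 (enc_set A ++ s) x = (x \in A).
Proof.
rewrite nth_cat size_enc_set ltn_ord (nth_map x) ?size_enum_ord //.
by rewrite nth_ord_enum.
Qed.

Lemma size_enc_graph (H : sgraph 'I_n) : size (enc_graph H) = n * n.
Proof. by rewrite size_allpairs size_enum_ord. Qed.

Lemma nth_enc_graph (H : sgraph 'I_n) (x y : 'I_n) s :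
  nth 0 (enc_graph H ++ s) (x * n + y) = adj H x y.
Proof.
rewrite nth_flatten_blocks ?size_map ?size_enum_ord //.
  rewrite (nth_map x) ?size_enum_ord // (nth_map y) ?size_enum_ord //.
  by rewrite !nth_ord_enum.
by apply/allP => t /mapP[z _ ->]; rewrite size_map size_enum_ord.
by rewrite -enumT size_enum_ord.
Qed.

Let block (j : 'I_d) := enc_set (dgamma j) ++ enc_graph (dtree j).

Lemma size_block j : size (block j) = n + n * n.
Proof. by rewrite size_cat size_enc_set size_enc_graph. Qed.

Lemma inp_split : inp = [:: n; f; tau] ++ enc_graph G ++ enc_set (dU D) ++
  [:: d] ++ flatten [seq block j | j <- enum 'I_d] ++ [::].
Proof. by rewrite cats0. Qed.

Lemma size_inp : N = 3 + n * n + n + 1 + d * (n + n * n).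
Proof.
rewrite /N inp_split !size_cat size_enc_graph size_enc_set size_flatten /= addn0.
rewrite /shape -map_comp (eq_map (g := fun=> n + n * n)) => [|j]; last exact: size_block.
rewrite (_ : sumn _ = d * (n + n * n)); first lia.
by rewrite -[in RHS](size_enum_ord d); elim: (enum _) => //= j s ->; rewrite mulSn.
Qed.

(** These bounds let loops, sums and arrays of length N range over vertices, pairs of vertices and
    the gamma_j. For n = 0 the encodings of the gamma_j are empty and say nothing about d. *)
Lemma inp_ge : [/\ n + 4 <= N, n * n <= N & 0 < n -> d <= N].
Proof.
rewrite size_inp; split; [lia|lia|] => n0.
apply: leq_trans (leq_addl _ _); apply: leq_pmulr; lia.
Qed.

Lemma nth_skip (s1 s2 : seq nat) k : nth 0 (s1 ++ s2) (size s1 + k) = nth 0 s2 k.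
Proof. by rewrite nth_cat ltnNge leq_addr /= addKn. Qed.

Lemma nth_skipE (s1 s2 : seq nat) m k :
  size s1 = m -> nth 0 (s1 ++ s2) (m + k) = nth 0 s2 k.
Proof. by move=> <-; exact: nth_skip. Qed.

Definition en := HIn (HC 0).
Definition ef := HIn (HC 1).
Definition etau := HIn (HC 2).
(** Variables 20, 21 and 22 are reserved for the bound variables of products. *)
Definition esq := hmul 20 en en.
Definition eadj x y := HIn (HAdd (HC 3) (HAdd (hmul 21 (HV x) en) (HV y))).
Definition eU x := HIn (HAdd (HC 3) (HAdd esq (HV x))).
Definition ed := HIn (HAdd (HC 3) (HAdd esq en)).
Definition eblock j :=
  HAdd (HC 4) (HAdd esq (HAdd en (hmul 21 (HV j) (HAdd en esq)))).
Definition egamma j x := HIn (HAdd (eblock j) (HV x)).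
Definition etree j p := HIn (HAdd (HAdd (eblock j) en) (HV p)).

Section Reading.
Variables (A : nat -> nat -> nat).
Implicit Types (v : nat -> nat).

Lemma hev_n v : hev inp A v en = n. Proof. by []. Qed.
Lemma hev_f v : hev inp A v ef = f. Proof. by []. Qed.
Lemma hev_tau v : hev inp A v etau = tau. Proof. by []. Qed.

Lemma hev_sq v : hev inp A v esq = n * n.
Proof.
apply: hev_mul => //; have [nN _ _] := inp_ge.
exact: leq_trans (leq_addr _ _) nN.
Qed.

Lemma hev_adj v x y (a b : 'I_n) :
  v x = a -> v y = b -> x != 21 -> hev inp A v (eadj x y) = adj G a b.
Proof.
move=> xa yb x21; rewrite /eadj !hevE yb.
have -> : hev inp A v (hmul 21 (HV x) en) = a * n.
  apply: hev_mul => //=; first by move=> i; rewrite update_other.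
  have [nN _ _] := inp_ge; apply: leq_trans (ltnW (ltn_ord a)) _.
  exact: leq_trans (leq_addr _ _) nN.
by rewrite inp_split (nth_skip [:: n; f; tau]) nth_enc_graph.
Qed.

Lemma hev_U v x (a : 'I_n) : v x = a -> hev inp A v (eU x) = (a \in dU D).
Proof.
move=> xa; rewrite /eU !hevE hev_sq xa.
rewrite inp_split (nth_skip [:: n; f; tau]) (nth_skipE _ _ (size_enc_graph G)).
exact: nth_enc_set.
Qed.

Lemma hev_d v : hev inp A v ed = d.
Proof.
rewrite /ed hev_In !hev_Add hev_sq hev_n.
rewrite inp_split (nth_skip [:: n; f; tau]) (nth_skipE _ _ (size_enc_graph G)).
by rewrite -[X in nth _ _ X]addn0 (nth_skipE _ _ (size_enc_set (dU D))).
Qed.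

Lemma hev_block v j (i : 'I_d) k : v j = i -> j \notin [:: 20; 21] ->
  k < n + n * n -> nth 0 inp (hev inp A v (eblock j) + k) = nth 0 (block i) k.
Proof.
move=> ji j21 kB.
have n0 : 0 < n by move: kB; case: (n).
have -> : hev inp A v (eblock j) = 3 + (n * n + (n + (1 + i * (n + n * n)))).
  rewrite /eblock !hev_Add hev_sq hev_n hev_C.
  rewrite (@hev_mul _ _ _ _ _ _ i (n + n * n)); first lia.
  - by move=> k'; rewrite hev_V update_other //; apply: contra j21 => /eqP ->.
  - by move=> k'; rewrite hev_Add hev_sq.
  - by have [_ _ /(_ n0)] := inp_ge; apply: leq_trans; apply: ltnW.
rewrite -!addnA inp_split (nth_skip [:: n; f; tau]) (nth_skipE _ _ (size_enc_graph G)).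
rewrite (nth_skipE _ _ (size_enc_set (dU D))) (nth_skip [:: d]).
rewrite nth_flatten_blocks ?size_map ?size_enum_ord //.
  by rewrite (nth_map i) ?size_enum_ord // nth_ord_enum.
by apply/allP => t /mapP[z _ ->]; rewrite size_block.
by rewrite -enumT size_enum_ord.
Qed.

Lemma hev_gamma v j x (i : 'I_d) (a : 'I_n) :
  v j = i -> v x = a -> j \notin [:: 20; 21] ->
  hev inp A v (egamma j x) = (a \in dgamma i).
Proof.
move=> ji xa j21; rewrite /egamma hev_In hev_Add hev_V xa (hev_block ji) //.
  exact: nth_enc_set.
by have := ltn_ord a; lia.
Qed.

Lemma hev_tree v j p (i : 'I_d) (a b : 'I_n) :
  v j = i -> v p = a * n + b -> j \notin [:: 20; 21] ->
  hev inp A v (etree j p) = adj (dtree i) a b.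
Proof.
move=> ji xa j21; rewrite /etree hev_In !hev_Add hev_V hev_n xa -addnA (hev_block ji) //.
  rewrite /block (nth_skipE _ _ (size_enc_set (dgamma i))) -[enc_graph _]cats0.
  by rewrite nth_enc_graph.
rewrite ltn_add2l; apply: (@leq_trans (a.+1 * n)).
  by rewrite mulSn addnC ltn_add2r.
by rewrite leq_mul2r ltn_ord orbT.
Qed.

End Reading.
End InputLayout.

Arguments hev_adj {n G f tau D A v x y a b}.
Arguments hev_U {n G f tau D A v x a}.
Arguments hev_gamma {n G f tau D A v j x i a}.
Arguments hev_tree {n G f tau D A v j p i a b}.
Arguments hspec_forlt {inp Inv R}.

(* Arrays: 0 powers of two, 1 their exponent, 2 labels, 3 levels, 4 the kept
   gamma_j, 5 the kept vertices, 6 forest edges, 7 loads. *)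
Definition efc := hmin ef en.
Definition elg := HA 1 (HC 0).
Definition efl := hmul 20 efc elg.
Definition eM := HAdd (hmin en (HAdd (HAdd efl efl) (HC 2))) (HC 1).
Definition ef1 := HAdd efc (HC 1).
Definition eK := HAdd (hmul 20 eM (hmul 21 eM (hmul 22 eM ef1))) (HC 1).
Definition eL := hmul 20 (hmin etau (HAdd en (HC 1))) (HAdd eK eK).

(** Finds the least lg with n <= 2^lg by doubling. A scalar is kept in cell 0 of an array whose
    other cells receive the same value. *)
Definition log_cmd :=
  HSeq (HTab 0 7 (HC 1))
       (HFor 0 (HIf (hlt (HA 0 (HC 0)) en)
          (HSeq (HTab 0 7 (HAdd (HA 0 (HC 0)) (HA 0 (HC 0))))
                (HTab 1 7 (HAdd (HA 1 (HC 0)) (HC 1)))))).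

(** Variables 0, 1, 2 hold the modulus and the two residues, 3 the index of the forest, 4 the
    hyperedge, 5 and 6 a pair of vertices. Congruence is tested by searching for the quotient, in
    variable 8. *)
Definition ein_class y :=
  let cl r := heq (HV y) (HAdd (hmul 20 (HV 8) (HV 0)) (HV r)) in
  hex 8 (hor (cl 1) (cl 2)).
Definition etouch y := hex 9 (hand (hlt (HV 9) en) (hand (egamma 4 9) (eadj y 9))).
Definition eside y := hand (eU y) (hand (etouch y) (ein_class y)).
Definition relabel_cmd :=
  HTab 2 7 (HIte (heq (HA 2 (HV 7)) (HA 2 (HV 6))) (HA 2 (HV 5)) (HA 2 (HV 7))).
Definition peel_step :=
  HIf (hand (hor (heq (HA 3 (HV 4)) (HC 0)) (heq (HA 3 (HV 4)) (HAdd (HV 3) (HC 1))))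
      (hand (eside 5) (hand (eside 6) (hne (HA 2 (HV 5)) (HA 2 (HV 6))))))
    (HSeq (HTab 3 7 (HIte (heq (HV 7) (HV 4)) (HAdd (HV 3) (HC 1)) (HA 3 (HV 7))))
    (HSeq (HTab 4 7 (HIte (heq (HV 7) (HV 4)) (HC 1) (HA 4 (HV 7)))) relabel_cmd)).
Definition peel_round :=
  HSeq (HTab 2 7 (HV 7)) (hforlt 4 ed (hforlt 5 en (hforlt 6 en peel_step))).
(** Levels start afresh for each modulus and pair of residues, whereas the marks of array 4
    accumulate: forests of different classes may share hyperedges. *)
Definition peel_pair := HSeq (HTab 3 7 (HC 0)) (hforlt 3 ef1 peel_round).
Definition peel_cmd := hforlt 0 eM (hforlt 1 eM (hforlt 2 eM peel_pair)).

(* f and tau are capped because products are sums of at most N terms.  The loads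
   add up to at most 2 (|U| + |J|) <= 2 (peel_factor + 1) |U|, whence max_load. *)
Section Caps.
Variables (n f tau lg : nat).
Definition cap_f := minn f n.
Definition num_moduli := (minn n (2 * (cap_f * lg) + 2)).+1.
Definition peel_factor := num_moduli * (num_moduli * (num_moduli * cap_f.+1)).
Definition max_load := minn tau n.+1 * (2 * peel_factor.+1).
End Caps.

Lemma tab_same inp A k g i : i < size inp -> tab inp A k g k i = g i.
Proof. by move=> iN; rewrite /tab eqxx iN. Qed.

Lemma tab_other inp A k k' g i : k' != k -> tab inp A k g k' i = A k' i.
Proof. by move=> /negbTE kk; rewrite /tab kk. Qed.

Lemma hrun_tab inp k r e v S : (hrun inp (HTab k r e) v S).1 =
  tab inp S.1 k (fun i => hev inp S.1 (update v r i) e).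
Proof. by []. Qed.

Lemma hrun_seq inp c1 c2 v S :
  hrun inp (HSeq c1 c2) v S = hrun inp c2 v (hrun inp c1 v S).
Proof. by []. Qed.

Lemma hrun_if inp e c v S :
  hrun inp (HIf e c) v S = if hev inp S.1 v e != 0 then hrun inp c v S else S.
Proof. by []. Qed.

(** * The sparsification phase *)

Section Peel.
Variables (n : nat) (G : sgraph 'I_n) (f tau : nat) (D : decomposition G).
Let inp := enc_input f D tau.
Let N := size inp.
Let d := dsize D.
Let U := dU D.

Lemma n_le_N : n < N.
Proof. by have [H _ _] := inp_ge f tau D; apply: leq_trans H; rewrite addn4; lia. Qed.

Lemma ord_lt_N (x : 'I_n) : x < N.
Proof. exact: ltn_trans (ltn_ord x) n_le_N. Qed.

Lemma d_le_N (x : 'I_n) : d <= N.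
Proof.
by have [_ _] := inp_ge f tau D; apply; apply: leq_ltn_trans (ltn_ord x).
Qed.

Section EvalParameters.
Variables (A : nat -> nat -> nat) (lg : nat).
Hypothesis Alg : A 1 0 = lg.

Lemma hev_efc v : hev inp A v efc = cap_f n f.
Proof. by rewrite hev_min hev_f hev_n. Qed.

Lemma hev_ef1 v : hev inp A v ef1 = (cap_f n f).+1.
Proof. by rewrite hev_Add hev_efc addn1. Qed.

Lemma hev_eM v : hev inp A v eM = num_moduli n f lg.
Proof.
rewrite /eM hev_Add hev_min hev_n !hev_Add hev_C addn1 /num_moduli.
rewrite (@hev_mul _ _ _ _ _ _ (cap_f n f) lg) ?mul2n ?addnn //.
- by move=> i; rewrite hev_efc.
- by apply: leq_trans (geq_minr _ _) (ltnW n_le_N).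
Qed.

Lemma num_moduli_le : num_moduli n f lg <= N.
Proof. by rewrite (leq_trans _ n_le_N) // ltnS geq_minl. Qed.

Lemma hev_eK v : hev inp A v eK = (peel_factor n f lg).+1.
Proof.
rewrite /eK hev_Add hev_C addn1 /peel_factor; congr _.+1.
apply: hev_mul num_moduli_le => i; first exact: hev_eM.
apply: hev_mul num_moduli_le => i'; first exact: hev_eM.
apply: hev_mul num_moduli_le => i''; first exact: hev_eM.
exact: hev_ef1.
Qed.

Lemma hev_eL v : hev inp A v eL = max_load n f tau lg.
Proof.
apply: hev_mul => [i|i|].
- by rewrite hev_min hev_tau hev_Add hev_n hev_C addn1.
- by rewrite hev_Add hev_eK mul2n addnn.
- by apply: leq_trans (geq_minr _ _) n_le_N.
Qed.

End EvalParameters.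

(** For a, b < m these are the vertices congruent to a or b modulo m, phrased with a bounded
    quotient as in [ein_class]. *)
Definition residue_class m a b : {set 'I_n} :=
  [set x : 'I_n | has (fun q => (x == q * m + a :> nat) || (x == q * m + b :> nat))
                      (iota 0 N)].

Definition side m a b (j : 'I_d) : {set 'I_n} :=
  touching G (@dgamma _ _ D) U j :&: residue_class m a b.

Lemma hev_eside A (v : nat -> nat) (y m a b : nat) (j : 'I_d) (x : 'I_n) :
  v 0 = m -> v 1 = a -> v 2 = b -> v 4 = j -> v y = x ->
  y \notin [:: 8; 9; 20; 21] -> hev inp A v (eside y) = (x \in side m a b j).
Proof.
move=> vm va vb vj vx; rewrite !in_cons !negb_or => /and5P[y8 y9 y20 y21 _].
have HT : hev inp A v (etouch y) = [exists w in dgamma j, adj G x w].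
  have HH i (w : 'I_n) : i = w :> nat ->
      (hev inp A (update v 9 i) (hand (hlt (HV 9) en) (hand (egamma 4 9) (eadj y 9))) != 0)
      = (w \in dgamma j) && adj G x w.
    move=> iw; rewrite hev_and hev_lt hev_V hev_n update_same hev_and.
    rewrite (hev_gamma (i := j) (a := w)) ?update_same ?update_other //.
    rewrite (hev_adj (a := x) (b := w)) ?update_same ?update_other //.
    by rewrite !nat_of_bool_neq0 iw ltn_ord.
  rewrite /etouch hev_ex; congr nat_of_bool; apply/hasP/existsP => [[i _ Hi]|[w Hw]].
    have im : i < n.
      by move: Hi; rewrite hev_and hev_lt hev_V hev_n update_same !nat_of_bool_neq0
         => /andP[].
    by exists (Ordinal im); rewrite -(HH i).
  by exists (val w); rewrite ?mem_iota ?ord_lt_N // (HH _ w).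
have HC : hev inp A v (ein_class y) = (x \in residue_class m a b).
  rewrite /ein_class hev_ex inE; congr nat_of_bool; apply: eq_in_has => q.
  rewrite mem_iota add0n => qN.
  have prod r c : v r = c -> r != 8 ->
      hev inp A (update v 8 q) (heq (HV y) (HAdd (hmul 20 (HV 8) (HV 0)) (HV r))) =
      (x == q * m + c :> nat).
    move=> vr r8.
    have Hm : hev inp A (update v 8 q) (hmul 20 (HV 8) (HV 0)) = q * m.
      apply: hev_mul => [i|i|]; last exact: ltnW.
        by rewrite hev_V update_other // update_same.
      by rewrite hev_V !update_other.
    by rewrite hev_eq hev_Add Hm !hev_V !update_other // vx vr.
  by rewrite hev_or (prod 1 a) // (prod 2 b) // !nat_of_bool_neq0.
rewrite /eside !hev_and (hev_U vx) HT HC !nat_of_bool_neq0 /side in_setI.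
by rewrite [in RHS]/touching [in RHS]inE andbA.
Qed.

Definition labels (S : hstate) : 'I_n -> nat := fun x => S.1 2 x.
(** The guard serves n = 0, where d may exceed N and resetting the array does not reach every j. *)
Definition levels (S : hstate) : 'I_d -> nat := fun j => if j < N then S.1 3 j else 0.
Definition marked (S : hstate) : {set 'I_d} := [set j : 'I_d | S.1 4 j != 0].

Definition base lg (S : hstate) : Prop :=
  [/\ S.2 = [::], S.1 1 0 = lg & forall i, S.1 7 i = 0].

Lemma base_tab lg S k r e v :
  k != 1 -> k != 7 -> base lg S -> base lg (hrun inp (HTab k r e) v S).
Proof.
move=> k1 k7 [h1 h2 h3]; split=> //; first by rewrite hrun_tab tab_other // eq_sym.
by move=> i; rewrite hrun_tab tab_other // eq_sym.
Qed.

Lemma labels_relabel (S : hstate) (v : nat -> nat) (y z : 'I_n) :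
  v 5 = y -> v 6 = z -> labels (hrun inp relabel_cmd v S) = relabel (labels S) y z.
Proof.
move=> vy vz; apply: functional_extensionality => x.
rewrite /labels hrun_tab tab_same ?ord_lt_N //.
rewrite hev_Ite hev_eq !hevE update_same !update_other // vy vz.
by rewrite nat_of_bool_neq0.
Qed.

Section Round.
Variables (lg m a b k c : nat).
Let Sj := side m a b.

Lemma side_sub j : Sj j \subset U.
Proof. by apply/subsetP => x; rewrite !inE => /andP[/andP[]]. Qed.

Definition round_ok (S : hstate) : Prop :=
  base lg S /\ round_inv U Sj k c (labels S) (levels S) (marked S).

Definition round_ext (_ : nat) (S S' : hstate) : Prop :=
  [/\ forall x y, labels S x = labels S y -> labels S' x = labels S' y,
      forall j, avail (levels S') k j -> avail (levels S) k j
    & marked S \subset marked S'].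

(** Labels only coarsen and availability is only lost during a round, so this persists once
    established. Hence a single pass over all j, y, z makes the forest maximal. *)
Definition merged (j : 'I_d) (y z : 'I_n) (S : hstate) : Prop :=
  avail (levels S) k j -> y \in Sj j -> z \in Sj j -> labels S y = labels S z.

Lemma round_ext_refl S : round_ext 0 S S.
Proof. by []. Qed.

Lemma round_ext_trans p q S S' S'' :
  round_ext p S S' -> round_ext q S' S'' -> round_ext (p + q) S S''.
Proof.
move=> [h1 h2 h3] [g1 g2 g3]; split; first by move=> x y /h1 /g1.
- by move=> j /g2 /h2.
- exact: subset_trans h3 g3.
Qed.

Lemma merged_ext j y z p S S' : round_ext p S S' -> merged j y z S -> merged j y z S'.
Proof. by move=> [h1 h2 _] H av yS zS; apply/h1/H/zS/yS/h2. Qed.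

Lemma peel_step_ok (v : nat -> nat) (j : 'I_d) (y z : 'I_n) :
  v 0 = m -> v 1 = a -> v 2 = b -> v 3 = k -> v 4 = j -> v 5 = y -> v 6 = z ->
  hspec inp round_ok round_ext peel_step v 0 (merged j y z).
Proof.
move=> v0 v1 v2 v3 v4 v5 v6 S [B RI].
have jN : j < N by apply: leq_trans (ltn_ord j) (d_le_N y).
rewrite /peel_step; set cond := hand _ _; set act := HSeq _ _.
have condE : (hev inp S.1 v cond != 0) =
    [&& avail (levels S) k j, y \in Sj j, z \in Sj j & labels S y != labels S z].
  rewrite /cond hev_and hev_and (hev_eside _ v0 v1 v2 v4 v5) //.
  rewrite hev_and (hev_eside _ v0 v1 v2 v4 v6) //.
  rewrite hev_ne hev_or !hev_eq !hevE v3 v4 v5 v6 addn1 /avail /levels jN.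
  by rewrite !nat_of_bool_neq0.
rewrite hrun_if condE; case: ifP => [/and4P[av yS zS yz]|nc]; last first.
  split=> // av yS zS; apply/eqP/negPn; move: nc.
  by rewrite av yS zS /= => /negbT.
set S' := hrun _ _ _ _.
have levE : levels S' = mark (levels S) k j.
  apply: functional_extensionality => i.
  have iN : i < N by apply: leq_trans (ltn_ord i) (d_le_N y).
  rewrite /levels iN /S' /act !hrun_seq !hrun_tab.
  rewrite tab_other // tab_other // tab_same // hev_Ite hev_eq !hevE update_same !update_other //.
  by rewrite v3 v4 addn1 nat_of_bool_neq0 /mark iN.
have markE : marked S' = j |: marked S.
  apply/setP => i; rewrite !inE /S' /act !hrun_seq !hrun_tab.
  have iN : i < N by apply: leq_trans (ltn_ord i) (d_le_N y).
  rewrite tab_other // tab_same // hev_Ite hev_eq !hevE tab_other //.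
  rewrite update_same update_other // v4 nat_of_bool_neq0 (inj_eq val_inj).
  by case: (i =P j).
have labE : labels S' = relabel (labels S) y z.
  rewrite /S' /act !hrun_seq (labels_relabel _ v5 v6).
  by congr relabel; apply: functional_extensionality => x;
     rewrite /labels !hrun_tab !tab_other.
split.
- split; last by rewrite levE markE labE; exact: (round_step side_sub RI av yS zS yz).
  by rewrite /S' /act !hrun_seq; do 3!apply: base_tab => //.
- split.
  + by move=> p q pq; rewrite labE; apply: relabel_eq.
  + move=> i; rewrite levE /avail /mark; case: (i =P j) => // -> _; exact: av.
  + by rewrite markE subsetUr.
- by move=> _ _ _; rewrite labE /relabel eqxx; case: eqP.
Qed.

Lemma peel_loops_ok (v : nat -> nat) S :
  v 0 = m -> v 1 = a -> v 2 = b -> v 3 = k -> round_ok S ->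
  let S' := hrun inp (hforlt 4 ed (hforlt 5 en (hforlt 6 en peel_step))) v S in
  [/\ round_ok S', marked S \subset marked S' & forall j y z, merged j y z S'].
Proof.
move=> v0 v1 v2 v3 RS.
have Hz w (j : 'I_d) (y : 'I_n) : w 0 = m -> w 1 = a -> w 2 = b -> w 3 = k ->
    w 4 = j -> w 5 = y ->
    hspec inp round_ok round_ext (hforlt 6 en peel_step) w (minn n N * 0)
      (fun S => forall i, i < minn n N -> forall z : 'I_n, i = z -> merged j y z S).
  move=> w0 w1 w2 w3 w4 w5; apply: hspec_forlt.
  - exact: round_ext_refl.
  - exact: round_ext_trans.
  - by [].
  - by move=> i p S1 S2 R12 H z iz; apply: merged_ext R12 (H z iz).
  - move=> i im; have im' : i < n by apply: leq_trans im (geq_minl _ _).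
    move=> S1 /(@peel_step_ok (update w 6 i) j y (Ordinal im')) [] // I1 R1 M1.
    by split=> // z iz; rewrite (_ : z = Ordinal im') //; apply: val_inj.
have Hy w (j : 'I_d) : w 0 = m -> w 1 = a -> w 2 = b -> w 3 = k -> w 4 = j ->
    hspec inp round_ok round_ext (hforlt 5 en (hforlt 6 en peel_step)) w
      (minn n N * (minn n N * 0))
      (fun S => forall i, i < minn n N -> forall y z : 'I_n, i = y -> merged j y z S).
  move=> w0 w1 w2 w3 w4; apply: hspec_forlt.
  - exact: round_ext_refl.
  - exact: round_ext_trans.
  - by [].
  - by move=> i p S1 S2 R12 H y z iy; apply: merged_ext R12 (H y z iy).
  - move=> i im; have im' : i < n by apply: leq_trans im (geq_minl _ _).
    move=> S1 /(@Hz (update w 5 i) j (Ordinal im')) [] // I1 R1 M1.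
    split=> // y z iy; rewrite (_ : y = Ordinal im'); last exact: val_inj.
    by apply: (M1 z) => //; rewrite leq_min ltn_ord ord_lt_N.
pose Q (i : nat) S := forall (j : 'I_d) (y z : 'I_n), i = j -> merged j y z S.
have HQ : hspec inp round_ok round_ext
    (hforlt 4 ed (hforlt 5 en (hforlt 6 en peel_step))) v
    (minn d N * (minn n N * (minn n N * 0)))
    (fun S => forall i, i < minn d N -> Q i S).
  apply: hspec_forlt.
  - exact: round_ext_refl.
  - exact: round_ext_trans.
  - by move=> S1 w _; apply: hev_d.
  - by move=> i p S1 S2 R12 H j y z ij; apply: merged_ext R12 (H j y z ij).
  - move=> i im; have im' : i < d by apply: leq_trans im (geq_minl _ _).
    move=> S1 /(@Hy (update v 4 i) (Ordinal im')) [] // I1 R1 M1.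
    split=> // j y z ij; rewrite (_ : j = Ordinal im'); last exact: val_inj.
    by apply: (M1 y) => //; rewrite leq_min ltn_ord ord_lt_N.
have [I1 [_ _ R1] M1] := HQ S RS; split=> // j y z.
apply: (M1 j) => //; rewrite leq_min ltn_ord /=.
exact: leq_trans (ltn_ord j) (d_le_N y).
Qed.

End Round.

(** The levels are quantified existentially because array 3 is overwritten when the next class is
    treated. *)
Definition peeled m a b (Jp : {set 'I_d}) : Prop :=
  exists used : 'I_d -> nat, (forall j, used j != 0 -> j \in Jp) /\
    forall k, k < (cap_f n f).+1 -> level_done (side m a b) used Jp k.

Lemma level_done_mono (S : 'I_d -> {set 'I_n}) used (Jp Jp' : {set 'I_d}) k :
  Jp \subset Jp' -> level_done S used Jp k -> level_done S used Jp' k.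
Proof.
by move=> JJ H j jJ; apply: H; apply: contra jJ; apply: (subsetP JJ).
Qed.

Lemma peeled_mono m a b (Jp Jp' : {set 'I_d}) :
  Jp \subset Jp' -> peeled m a b Jp -> peeled m a b Jp'.
Proof.
move=> JJ [used [H1 H2]]; exists used; split; first by move=> j /H1 /(subsetP JJ).
by move=> k kf; apply: level_done_mono JJ (H2 k kf).
Qed.

Definition grows cost (S S' : hstate) : Prop :=
  marked S \subset marked S' /\ #|marked S'| <= #|marked S| + cost.

Lemma grows_refl S : grows 0 S S.
Proof. by split; rewrite ?addn0. Qed.

Lemma grows_trans p q S S' S'' : grows p S S' -> grows q S' S'' -> grows (p + q) S S''.
Proof.
move=> [h1 h2] [g1 g2]; split; first exact: subset_trans h1 g1.
by apply: leq_trans g2 _; rewrite addnA leq_add2r.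
Qed.

Lemma marked_tab S v k r e : k != 4 -> marked (hrun inp (HTab k r e) v S) = marked S.
Proof. by move=> k4; apply/setP => j; rewrite !inE hrun_tab tab_other // eq_sym. Qed.

Lemma levels_tab S v k r e : k != 3 -> levels (hrun inp (HTab k r e) v S) = levels S.
Proof.
by move=> k3; apply: functional_extensionality => j; rewrite /levels hrun_tab tab_other // eq_sym.
Qed.

Lemma peel_pair_ok lg m a b (v : nat -> nat) :
  v 0 = m -> v 1 = a -> v 2 = b ->
  hspec inp (base lg) grows peel_pair v ((cap_f n f).+1 * #|U|)
    (fun S => peeled m a b (marked S)).
Proof.
move=> v0 v1 v2 S B; rewrite /peel_pair hrun_seq.
set S0 := hrun _ (HTab 3 7 _) v S.
pose P k S' := [/\ base lg S', marked S \subset marked S',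
  #|marked S'| <= #|marked S| + k * #|U|, forall j, levels S' j != 0 -> j \in marked S'
  & forall k', k' < k -> level_done (side m a b) (levels S') (marked S') k'].
have f1N : (cap_f n f).+1 <= N.
  by apply: leq_trans n_le_N; rewrite ltnS geq_minr.
have : P (minn (cap_f n f).+1 N) (hrun inp (hforlt 3 ef1 peel_round) v S0).
  apply: hrun_forlt.
  - by move=> i S' _ w; apply: hev_ef1.
  - have B0 : base lg S0 by apply: base_tab B.
    have M0 : marked S0 = marked S by apply: marked_tab.
    split=> //; rewrite ?M0 ?mul0n ?addn0 //.
    + move=> j; rewrite /levels /S0 hrun_tab.
      by case: ifP => // jN; rewrite tab_same.
  move=> k S' kf [B' MS cM uM dM].
  rewrite /peel_round hrun_seq.
  set S1 := hrun _ (HTab 2 7 _) _ S'.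
  have lab1 x y : labels S1 x = labels S1 y -> x = y.
    rewrite /labels /S1 !hrun_tab !tab_same ?ord_lt_N // !hev_V !update_same.
    exact: val_inj.
  have mE : marked S1 = marked S' by apply: marked_tab.
  have lE : levels S1 = levels S' by apply: levels_tab.
  have R1 : round_ok lg m a b k #|marked S'| S1.
    split; first by apply: base_tab B'.
    split.
    + by move=> x y /lab1 ->; apply: connect0.
    + by rewrite mE leq_add2l nlab_le.
    + by rewrite mE lE.
    + by move=> k' kk; rewrite mE lE; apply: dM.
  have [] := @peel_loops_ok lg m a b k #|marked S'| (update v 3 k) S1.
  - by rewrite update_other.
  - by rewrite update_other.
  - by rewrite update_other.
  - by rewrite update_same.
  - exact: R1.
  rewrite mE; set S2 := hrun _ _ _ S1 => -[B2 [c2 m2 u2 d2]] MM H.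
  split=> //.
  - exact: subset_trans MS MM.
  - apply: leq_trans (leq_trans (leq_addr _ _) m2) _.
    by rewrite mulSn [#|U| + _]addnC addnA leq_add2r.
  move=> k'; rewrite ltnS leq_eqVlt => /orP[/eqP ->|]; last exact: d2.
  (* An unmarked hyperedge is on no level, hence still available, so its vertices have been
     merged. *)
  move=> j jJ y z yS zS; apply: c2; apply: H yS zS.
  by rewrite /avail; case: eqP => // /eqP /u2; rewrite (negbTE jJ).
rewrite (minn_idPl f1N); case=> B' MS cM uM dM; split=> //.
by exists (levels (hrun inp (hforlt 3 ef1 peel_round) v S0)).
Qed.

Lemma peel_ok lg S : base lg S ->
  let S' := hrun inp peel_cmd (fun=> 0) S in
  [/\ base lg S', #|marked S'| <= #|marked S| + peel_factor n f lg * #|U|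
    & forall m a b, m < num_moduli n f lg -> a < num_moduli n f lg ->
      b < num_moduli n f lg -> peeled m a b (marked S')].
Proof.
move=> BS; set M := num_moduli n f lg.
have MN : M <= N := num_moduli_le lg.
pose c0 := (cap_f n f).+1 * #|U|.
have ev S1 w : base lg S1 -> hev inp S1.1 w eM = M by move=> [_ H _]; apply: hev_eM.
have H3 v m a : v 0 = m -> v 1 = a ->
    hspec inp (base lg) grows (hforlt 2 eM peel_pair) v (minn M N * c0)
      (fun S => forall b, b < minn M N -> peeled m a b (marked S)).
  move=> v0 v1; apply: hspec_forlt => //; first exact: grows_refl.
  - exact: grows_trans.
  - by move=> i p S1 S2 [R12 _]; apply: peeled_mono.
  - by move=> b _; apply: peel_pair_ok; rewrite ?update_same ?update_other.
have H2 v m : v 0 = m ->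
    hspec inp (base lg) grows (hforlt 1 eM (hforlt 2 eM peel_pair)) v
      (minn M N * (minn M N * c0))
      (fun S => forall a, a < minn M N -> forall b, b < minn M N -> peeled m a b (marked S)).
  move=> v0; apply: hspec_forlt => //; first exact: grows_refl.
  - exact: grows_trans.
  - by move=> i p S1 S2 [R12 _] H b bM; apply: peeled_mono R12 (H b bM).
  - by move=> a _; apply: H3; rewrite ?update_same ?update_other.
have H1 : hspec inp (base lg) grows peel_cmd (fun=> 0)
      (minn M N * (minn M N * (minn M N * c0)))
      (fun S => forall m, m < minn M N -> forall a, a < minn M N ->
                forall b, b < minn M N -> peeled m a b (marked S)).
  apply: hspec_forlt => //; first exact: grows_refl.
  - exact: grows_trans.
  - by move=> i p S1 S2 [R12 _] H a aM b bM; apply: peeled_mono R12 (H a aM b bM).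
  - by move=> a _; apply: H2; rewrite ?update_same.
have [B1 [_ c1] P1] := H1 S BS; rewrite (minn_idPl MN) in c1 P1.
split=> //; last by move=> m a b mM aM bM; apply: P1.
by rewrite /peel_factor -!mulnA.
Qed.

End Peel.

Definition ekept x :=
  hex 4 (hand (hlt (HV 4) ed) (hand (HA 4 (HV 4)) (egamma 4 x))).
(* The label of gamma_j is its largest vertex, obtained as the number of i below
   some vertex of gamma_j. *)
Definition einit_label := HIte (ekept 7)
  (HSum 8 (hex 4 (hand (hlt (HV 4) ed) (hand (hand (HA 4 (HV 4)) (egamma 4 7))
     (hex 9 (hand (hlt (HV 9) en) (hand (egamma 4 9) (hlt (HV 8) (HV 9)))))))))
  (HV 7).
Definition init_cmd :=
  HSeq (HTab 5 7 (hor (eU 7) (ekept 7)))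
  (HSeq (HTab 2 7 einit_label)
        (HTab 6 7 (hand (hlt (HV 7) esq)
           (hex 4 (hand (hlt (HV 4) ed) (hand (HA 4 (HV 4)) (etree 4 7))))))).

Definition epair x y := HAdd (hmul 20 (HV x) en) (HV y).
Definition forest_step_cmd :=
  HIf (hand (eadj 5 6) (hand (HA 5 (HV 5)) (hand (HA 5 (HV 6))
      (hand (hlt (HA 7 (HV 5)) eL) (hand (hlt (HA 7 (HV 6)) eL)
            (hne (HA 2 (HV 5)) (HA 2 (HV 6))))))))
    (HSeq (HTab 6 7 (hor (hor (heq (HV 7) (epair 5 6)) (heq (HV 7) (epair 6 5)))
                         (HA 6 (HV 7))))
    (HSeq (HTab 7 7 (HAdd (HA 7 (HV 7)) (hor (heq (HV 7) (HV 5)) (heq (HV 7) (HV 6)))))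
          relabel_cmd)).
Definition forest_cmd := hforlt 5 en (hforlt 6 en forest_step_cmd).

Definition emit_cmd :=
  HSeq (hforlt 5 en (HEmit (HIte (hlt (HA 7 (HV 5)) eL) (HC 0) (HC 1))))
  (HSeq (HEmit en)
  (hforlt 4 en (HSeq
     (hforlt 5 en (HEmit (hand (HA 5 (HV 5)) (heq (HA 2 (HV 5)) (HV 4)))))
     (hforlt 5 en (hforlt 6 en (HEmit (hand (HA 6 (epair 5 6))
        (hand (heq (HA 2 (HV 5)) (HV 4)) (heq (HA 2 (HV 6)) (HV 4))))))))))
.

Definition decomp_cmd :=
  HSeq log_cmd (HSeq peel_cmd (HSeq init_cmd (HSeq forest_cmd emit_cmd))).

Lemma pair_index_inj n (u w x y : 'I_n) :
  (u * n + w == x * n + y) = (u == x) && (w == y).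
Proof.
have n0 : 0 < n by apply: leq_ltn_trans (ltn_ord u).
apply/eqP/andP => [E|[/eqP -> /eqP ->] //].
have := congr1 (fun k => k %/ n) E; have := congr1 (fun k => k %% n) E.
rewrite !modnMDl !divnMDl // !modn_small // !divn_small // !addn0.
by move=> /val_inj -> /val_inj ->.
Qed.

Lemma pair_index_lt n (x y : 'I_n) : x * n + y < n * n.
Proof.
apply: (@leq_trans (x.+1 * n)); first by rewrite mulSn addnC ltn_add2r.
by rewrite leq_mul2r ltn_ord orbT.
Qed.

Lemma ltn_bigmax (I : finType) (A : {set I}) (F : I -> nat) i :
  (i < \max_(z in A) F z) = [exists z in A, i < F z].
Proof.
apply/idP/existsP => [im|[z /andP[zA iz]]].
  apply/existsP; move: im; apply: contraLR => /existsPn H.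
  rewrite -leqNgt; apply/bigmax_leqP => z zA.
  by have := H z; rewrite zA /= -leqNgt.
exact: leq_trans iz (leq_bigmax_cond _ zA).
Qed.

Lemma hev_ex_lt inp A v r e eb m (P : 'I_m -> bool) :
  m <= size inp -> (forall w, hev inp A w eb = m) ->
  (forall x : 'I_m, (hev inp A (update v r x) e != 0) = P x) ->
  hev inp A v (hex r (hand (hlt (HV r) eb) e)) = [exists x, P x].
Proof.
move=> mN ebm eP; rewrite hev_ex; congr nat_of_bool.
have HH i : (hev inp A (update v r i) (hand (hlt (HV r) eb) e) != 0) =
    (i < m) && (hev inp A (update v r i) e != 0).
  by rewrite hev_and hev_lt hev_V update_same ebm !nat_of_bool_neq0.
apply/hasP/existsP => [[i _]|[x Px]].
  by rewrite HH => /andP[im ei]; exists (Ordinal im); rewrite -eP.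
exists (val x); first by rewrite mem_iota /= (leq_trans (ltn_ord x)).
by rewrite HH ltn_ord eP.
Qed.

(** * The logarithm, the initial forest, Kruskal's algorithm and the output *)

Section Phases.
Variables (n : nat) (G : sgraph 'I_n) (f tau : nat) (D : decomposition G).
Let inp := enc_input f D tau.
Let N := size inp.
Let d := dsize D.
Let U := dU D.

Lemma log_ok :
  let S := hrun inp log_cmd (fun=> 0) hinit in
  exists lg, [/\ base lg S, marked D S = set0, n <= 2 ^ lg
               & lg = 0 \/ 2 ^ lg.-1 < n].
Proof.
have N0 : 0 < N by apply: leq_ltn_trans (n_le_N f tau D).
rewrite /log_cmd hrun_seq; set S0 := hrun _ _ _ hinit.
(* Either the power has reached n, or every round so far has doubled it; N rounds are enough because
   n <= 2^N. *)
pose P i (S : hstate) := exists e, [/\ base e S, marked D S = set0,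
   S.1 0 0 = 2 ^ e, e = 0 \/ 2 ^ e.-1 < n & n <= 2 ^ e \/ e = i].
set S1 := hrun _ _ _ _.
have : P N S1.
  apply: hrun_for.
    exists 0; split; rewrite /S0; [split=> //| | | by left | by right].
    - by rewrite marked_tab //; apply/setP => j; rewrite !inE.
    - by rewrite hrun_tab tab_same.
  move=> i S iN [e [B M P0 low up]]; rewrite hrun_if hev_lt hev_A hev_C hev_n P0.
  rewrite nat_of_bool_neq0; case: ltnP => nP; last by exists e; split=> //; left.
  have [b1 b2 b3] := B.
  exists e.+1; split.
  - split=> //.
    by rewrite hrun_seq !hrun_tab tab_same // hev_Add hev_A !hev_C tab_other // b2 addn1.
  - by rewrite hrun_seq !marked_tab.
  - rewrite hrun_seq !hrun_tab tab_other // tab_same // hev_Add hev_A hev_C P0.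
    by rewrite addnn -mul2n -expnS.
  - by right.
  - by case: up => [|->]; [rewrite leqNgt nP|right].
case=> e [B M P0 low up]; exists e; split=> //.
case: up => // ->; apply: leq_trans (ltnW (n_le_N f tau D)) _.
by apply: ltnW; apply: ltn_expl.
Qed.

Section Kept.
Variables (lg : nat) (Jp : {set 'I_d}).
Let W := kept (@dgamma _ _ D) U Jp.
Let L := max_load n f tau lg.

Definition edges (S : hstate) : rel 'I_n := fun x y => S.1 6 (x * n + y) != 0.
Definition loads (S : hstate) : 'I_n -> nat := fun x => S.1 7 x.

Definition forest_ok (S : hstate) : Prop :=
  [/\ S.2 = [::], S.1 1 0 = lg, forall x : 'I_n, S.1 5 x = (x \in W),
      forall x : 'I_n, labels S x < n
    & forest_inv G W (decomp_degree D) (2 * (#|U| + #|Jp|)) L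
        (labels S) (edges S) (loads S)].

Lemma hev_ekept (A : nat -> nat -> nat) (v : nat -> nat) x (a : 'I_n) :
  (forall j : 'I_d, (A 4 j != 0) = (j \in Jp)) -> v x = a -> x != 4 ->
  hev inp A v (ekept x) = [exists j in Jp, a \in dgamma j].
Proof.
move=> AJ xa x4; apply: hev_ex_lt; first exact: d_le_N a.
  by move=> w; apply: hev_d.
move=> j; rewrite hev_and (hev_gamma (i := j) (a := a)) ?update_same ?update_other //.
by rewrite hev_A hev_V update_same AJ !nat_of_bool_neq0.
Qed.

Lemma mem_kept (x : 'I_n) : (x \in W) = (x \in U) || [exists j in Jp, x \in dgamma j].
Proof.
rewrite inE; congr orb; apply/bigcupP/existsP => [[j jJ xj]|[j /andP[jJ xj]]].
  by exists j; rewrite jJ.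
by exists j.
Qed.

Let top (j : 'I_d) : nat := \max_(z in dgamma (d := D) j) z.

Lemma top_mem j (x : 'I_n) : x \in dgamma j -> exists2 z : 'I_n, z \in dgamma j & top j = z.
Proof.
move=> xj; have [|z zj E] := @eq_bigmax_cond _ (mem (dgamma j)) (@nat_of_ord n).
  by apply/card_gt0P; exists x.
by exists z.
Qed.

Lemma hev_einit_label (A : nat -> nat -> nat) (v : nat -> nat) (x : 'I_n) :
  (forall j : 'I_d, (A 4 j != 0) = (j \in Jp)) -> v 7 = x ->
  (forall j, j \in Jp -> x \in dgamma j -> hev inp A v einit_label = top j) /\
  (~~ [exists j in Jp, x \in dgamma j] -> hev inp A v einit_label = x).
Proof.
move=> AJ vx; split=> [j jJ xj|nj]; rewrite /einit_label hev_Ite (hev_ekept AJ vx) //;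
    rewrite nat_of_bool_neq0; last by rewrite (negbTE nj).
rewrite ifT; last by apply/existsP; exists j; rewrite jJ.
have topN : top j <= N.
  have [z _ ->] := top_mem xj.
  by apply: ltnW; apply: (ord_lt_N f tau D z).
rewrite hev_Sum -[RHS](minn_idPl topN) -sum_ltn; apply: eq_bigr => i _.
have dN := d_le_N f tau D x.
rewrite (@hev_ex_lt _ _ _ _ _ _ d
  (fun j' => [&& j' \in Jp, x \in dgamma j' & i < top j'])) //.
- congr nat_of_bool; apply/existsP/idP => [[j' /and3P[_ xj' H]]|H].
    by rewrite (gamma_inj (@dgamma_disjoint _ _ D) xj xj').
  by exists j; rewrite jJ xj.
- by move=> w; apply: hev_d.
- move=> j'; rewrite hev_and hev_and.
  rewrite (@hev_ex_lt _ _ _ _ _ _ n (fun z : 'I_n => (z \in dgamma j') && (i < z))) //.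
  + rewrite (hev_gamma (i := j') (a := x)) ?update_same ?update_other //.
    rewrite hev_A hev_V update_same AJ !nat_of_bool_neq0 -andbA.
    by rewrite /top ltn_bigmax.
  + by apply: ltnW; apply: n_le_N.
  + move=> z; rewrite hev_and (hev_gamma (i := j') (a := z)); upd=> //.
    by rewrite hev_lt !hev_V; upd; rewrite !nat_of_bool_neq0.
Qed.

(** Each initial label is a vertex of the class it names: the largest vertex of a kept gamma_j, or
    the vertex itself outside these. The classes are disjoint, so distinct classes get distinct
    labels. *)
Lemma init_ok S : base lg S -> marked D S = Jp ->
  forest_ok (hrun inp init_cmd (fun=> 0) S).
Proof.
move=> [b1 b2 b3] mJ; rewrite /init_cmd !hrun_seq.
have AJ (j : 'I_d) : (S.1 4 j != 0) = (j \in Jp) by rewrite -mJ inE.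
set S1 := hrun _ (HTab 5 7 _) _ S; set S2 := hrun _ (HTab 2 7 _) _ S1.
set S3 := hrun _ _ _ S2.
have A1 (j : 'I_d) : (S1.1 4 j != 0) = (j \in Jp) by rewrite /S1 hrun_tab tab_other.
have A2 (j : 'I_d) : (S2.1 4 j != 0) = (j \in Jp) by rewrite /S2 hrun_tab tab_other.
have labE (x : 'I_n) : labels S3 x = hev inp S1.1 (update (fun=> 0) 7 x) einit_label.
  by rewrite /labels /S3 hrun_tab tab_other // /S2 hrun_tab tab_same ?ord_lt_N.
have vx (x : 'I_n) : update (fun=> 0) 7 x 7 = x by rewrite update_same.
have lab1 j (x : 'I_n) : j \in Jp -> x \in dgamma j -> labels S3 x = top j.
  by rewrite labE => jJ xj; have [H _] := hev_einit_label A1 (vx x); apply: H.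
have lab2 (x : 'I_n) : ~~ [exists j in Jp, x \in dgamma j] -> labels S3 x = x.
  by rewrite labE; have [_ H] := hev_einit_label A1 (vx x).
have WE (x : 'I_n) : S3.1 5 x = (x \in W).
  rewrite /S3 hrun_tab tab_other // /S2 hrun_tab tab_other // /S1 hrun_tab tab_same ?ord_lt_N //.
  rewrite hev_or (hev_U (a := x)) ?update_same // (hev_ekept AJ (a := x)) ?update_same //.
  by rewrite !nat_of_bool_neq0 mem_kept.
have EE : edges S3 = tree_rel Jp.
  apply: functional_extensionality => x; apply: functional_extensionality => y.
  rewrite /edges /S3 hrun_tab tab_same; last first.
    by apply: leq_trans (pair_index_lt x y) _; have [] := inp_ge f tau D.
  rewrite hev_and hev_lt hev_V update_same hev_sq pair_index_lt.
  rewrite (@hev_ex_lt _ _ _ _ _ _ d (fun j => (j \in Jp) && adj (dtree j) x y)).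
  - by rewrite !nat_of_bool_neq0.
  - exact: d_le_N x.
  - by move=> w; apply: hev_d.
  - move=> j; rewrite hev_and (hev_tree (i := j) (a := x) (b := y)); upd=> //.
    by rewrite hev_A hev_V update_same A2 !nat_of_bool_neq0.
have LE : loads S3 = (fun=> 0).
  by apply: functional_extensionality => x; rewrite /loads /S3 !hrun_tab !tab_other ?b3.
split=> //.
- move=> x; have [/existsP[j /andP[jJ xj]]|nx] := boolP [exists j in Jp, x \in dgamma j].
    by rewrite (lab1 j) //; have [z _ ->] := top_mem xj.
  by rewrite lab2.
- rewrite EE LE; apply: forest_init => [j x y jJ xj yj|x y xW yW].
    by rewrite !(lab1 j).
  have [/existsP[j /andP[jJ xj]]|nx] := boolP [exists j in Jp, x \in dgamma j];
  have [/existsP[i /andP[iJ yi]]|ny] := boolP [exists j in Jp, y \in dgamma j].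
  + rewrite (lab1 j) // (lab1 i) // => E; right; exists j; rewrite ?xj //.
    have [z zj zE] := top_mem xj; have [z' zi zE'] := top_mem yi.
    have zz : z = z' by apply: val_inj; rewrite /= -zE -zE' E.
    by rewrite (gamma_inj (@dgamma_disjoint _ _ D) zj (j := i)) // zz.
  + rewrite (lab1 j) // (lab2 y) // => E; case/negP: ny.
    have [z zj zE] := top_mem xj; apply/existsP; exists j; rewrite jJ.
    by rewrite (_ : y = z) //; apply: val_inj; rewrite /= -zE E.
  + rewrite (lab1 i y) // (lab2 x) // => E; case/negP: nx.
    have [z zi zE] := top_mem yi; apply/existsP; exists i; rewrite iJ.
    by rewrite (_ : x = z) //; apply: val_inj; rewrite /= -zE E.
  + by rewrite !lab2 // => /val_inj; left.
Qed.

Definition forest_ext (_ : nat) (S S' : hstate) : Prop :=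
  (forall x y : 'I_n, labels S x = labels S y -> labels S' x = labels S' y) /\
  (forall x, loads S x <= loads S' x).

(** Since loads only grow and labels only coarsen, an edge rejected once would be rejected again;
    one pass over the edges suffices. *)
Definition crossed (x y : 'I_n) (S : hstate) : Prop :=
  x \in W -> y \in W -> adj G x y ->
  [|| L <= loads S x, L <= loads S y | labels S x == labels S y].

Lemma crossed_ext x y p S S' : forest_ext p S S' -> crossed x y S -> crossed x y S'.
Proof.
move=> [h1 h2] H xW yW xy; have /or3P[H1|H1|/eqP H1] := H xW yW xy.
- by rewrite (leq_trans H1 (h2 x)).
- by rewrite (leq_trans H1 (h2 y)) orbT.
- by rewrite (h1 _ _ H1) eqxx !orbT.
Qed.

Lemma hev_epair (A : nat -> nat -> nat) (v : nat -> nat) (x y : nat) (a b : 'I_n) :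
  v x = a -> v y = b -> x != 20 -> hev inp A v (epair x y) = a * n + b.
Proof.
move=> xa yb x20; rewrite /epair hev_Add hev_V yb; congr addn.
apply: hev_mul => [i|//|]; first by rewrite hev_V update_other.
by apply: ltnW; apply: ord_lt_N.
Qed.

Arguments hev_epair {A v x y a b}.

Lemma forest_step_ok (v : nat -> nat) (x y : 'I_n) :
  v 5 = x -> v 6 = y ->
  hspec inp forest_ok forest_ext forest_step_cmd v 0 (crossed x y).
Proof.
move=> v5 v6 S [o1 lgE WE labn FI].
rewrite /forest_step_cmd; set cond := hand _ _; set act := HSeq _ _.
have condE : (hev inp S.1 v cond != 0) =
    [&& adj G x y, x \in W, y \in W, loads S x < L, loads S y < L
      & labels S x != labels S y].
  rewrite /cond hev_and (hev_adj v5 v6) // hev_and hev_and hev_and hev_and.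
  rewrite hev_ne !hev_lt !hevE (hev_eL _ _ _ lgE) v5 v6 !WE.
  by rewrite !nat_of_bool_neq0.
rewrite hrun_if condE; case: ifP => [/and5P[xy xW yW Lx /andP[Ly lxy]]|nc]; last first.
  split=> // xW yW xy; move: nc; rewrite xy xW yW /= 2!ltnNge.
  by case: (L <= loads S x); case: (L <= loads S y); case: (labels S x == labels S y).
set S' := hrun _ _ _ _.
have edgeE : edges S' = add_edge (edges S) x y.
  apply: functional_extensionality => u; apply: functional_extensionality => w.
  rewrite /edges /S' /act !hrun_seq !hrun_tab tab_other // tab_other // tab_same; last first.
    by apply: leq_trans (pair_index_lt u w) _; have [] := inp_ge f tau D.
  rewrite hev_or hev_or !hev_eq (hev_epair (a := x) (b := y)) ?update_other //.
  rewrite (hev_epair (a := y) (b := x)) ?update_other // !hevE update_same.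
  by rewrite !nat_of_bool_neq0 !pair_index_inj orbC.
have loadE : loads S' = add_load (loads S) x y.
  apply: functional_extensionality => u.
  rewrite /loads /S' /act !hrun_seq !hrun_tab tab_other // tab_same ?ord_lt_N //.
  rewrite hev_Add hev_or !hev_eq !hevE update_same !update_other // v5 v6 tab_other //.
  by rewrite !nat_of_bool_neq0.
have labE : labels S' = relabel (labels S) x y.
  rewrite /S' /act !hrun_seq (labels_relabel _ _ _ _ v5 v6).
  by congr relabel; apply: functional_extensionality => u;
     rewrite /labels !hrun_tab !tab_other.
split.
- split=> //.
  + by move=> u; rewrite labE /relabel; case: ifP.
  + by rewrite edgeE loadE labE; apply: forest_step.
- split; first by move=> p q pq; rewrite labE; apply: relabel_eq.
  by move=> u; rewrite loadE /add_load leq_addr.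
- by move=> _ _ _; rewrite labE /relabel eqxx (negbTE lxy) eqxx !orbT.
Qed.

Lemma forest_cmd_ok S : forest_ok S ->
  let S' := hrun inp forest_cmd (fun=> 0) S in
  forest_ok S' /\ forall x y, crossed x y S'.
Proof.
move=> FS.
have erefl' S0 : forest_ext 0 S0 S0 by [].
have etrans p q S1 S2 S3 : forest_ext p S1 S2 -> forest_ext q S2 S3 ->
    forest_ext (p + q) S1 S3.
  move=> [h1 h2] [g1 g2]; split; first by move=> x y /h1 /g1.
  by move=> x; apply: leq_trans (h2 x) (g2 x).
have nN : minn n N = n by apply/minn_idPl; apply: ltnW; apply: n_le_N.
have Hy (v : nat -> nat) (x : 'I_n) : v 5 = x ->
    hspec inp forest_ok forest_ext (hforlt 6 en forest_step_cmd) v (minn n N * 0)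
      (fun S => forall i, i < minn n N -> forall y : 'I_n, i = y -> crossed x y S).
  move=> v5; apply: hspec_forlt => //.
  - by move=> i p S1 S2 R12 H y iy; apply: crossed_ext R12 (H y iy).
  - move=> i; rewrite nN => im S1 /(@forest_step_ok (update v 6 i) x (Ordinal im)) [] //.
    move=> I1 R1 M1; split=> // y iy; rewrite (_ : y = Ordinal im) //; exact: val_inj.
pose Q (i : nat) S := forall x y : 'I_n, i = x -> crossed x y S.
have HQ : hspec inp forest_ok forest_ext forest_cmd (fun=> 0)
    (minn n N * (minn n N * 0)) (fun S => forall i, i < minn n N -> Q i S).
  apply: hspec_forlt => //.
  - by move=> i p S1 S2 R12 H x y ix; apply: crossed_ext R12 (H x y ix).
  - move=> i; rewrite {1}nN => im S1.
    move=> /(@Hy (update (fun=> 0) 5 i) (Ordinal im)) [] // I1 R1 M1.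
    split=> // x y ix; rewrite (_ : x = Ordinal im); last exact: val_inj.
    by apply: (M1 y) => //; rewrite nN.
have [I1 _ M1] := HQ S FS; split=> // x y.
by apply: (M1 x) => //; rewrite nN.
Qed.

(** The invariant is a named argument because the trees of [parts_decomposition] are records built
    from its proof. *)
Lemma emit_ok (S : hstate) (FI : forest_inv G W (decomp_degree D)
    (2 * (#|U| + #|Jp|)) L (labels S) (edges S) (loads S)) :
  S.2 = [::] -> S.1 1 0 = lg -> (forall x : 'I_n, S.1 5 x = (x \in W)) ->
  (hrun inp emit_cmd (fun=> 0) S).2 =
  enc_decomp (parts_decomposition FI [set x | L <= loads S x]).
Proof.
move=> o1 lgE WE.
have nN : n <= N by apply: ltnW; apply: n_le_N.
transitivity (hrun inp emit_cmd (fun=> 0) (S.1, [::])).2.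
  by rewrite -o1 -surjective_pairing.
have : emits inp emit_cmd (fun=> 0) S.1
   (enc_decomp (parts_decomposition FI [set x | L <= loads S x])).
  apply: emits_seq.
    have -> : enc_set (dU (parts_decomposition FI [set x | L <= loads S x])) =
        flatten [seq [:: nat_of_bool (L <= loads S x)] | x <- enum 'I_n].
      by rewrite flatten_map1; apply: eq_map => x; rewrite inE.
    apply: emits_forlt => // x.
    rewrite (_ : nat_of_bool _ = hev inp S.1 (update (fun=> 0) 5 x)
      (HIte (hlt (HA 7 (HV 5)) eL) (HC 0) (HC 1))); first exact: emits_emit.
    rewrite hev_Ite hev_lt (hev_eL _ _ _ lgE) !hevE update_same nat_of_bool_neq0.
    by rewrite ltnNge -/L /loads; case: (_ <= _).
  rewrite -cat1s; apply: emits_seq; first exact: emits_emit.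
  apply: emits_forlt => // i; apply: emits_seq.
    rewrite -[enc_set _]/[seq _ | x <- _] -flatten_map1.
    apply: emits_forlt => // x.
    rewrite (_ : nat_of_bool _ = hev inp S.1 (update (update (fun=> 0) 4 i) 5 x)
      (hand (HA 5 (HV 5)) (heq (HA 2 (HV 5)) (HV 4)))); first exact: emits_emit.
    rewrite hev_and hev_eq !hevE update_same update_other // update_same WE.
    by rewrite !nat_of_bool_neq0 inE.
  apply: emits_forlt => // x; rewrite -flatten_map1.
  apply: emits_forlt => // y.
  rewrite (_ : nat_of_bool _ = hev inp S.1
    (update (update (update (fun=> 0) 4 i) 5 x) 6 y)
    (hand (HA 6 (epair 5 6))
        (hand (heq (HA 2 (HV 5)) (HV 4)) (heq (HA 2 (HV 6)) (HV 4)))));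
    first exact: emits_emit.
  rewrite hev_and hev_and !hev_eq hev_A (hev_epair (a := x) (b := y)) //.
  rewrite !hevE; upd.
  by rewrite !nat_of_bool_neq0.
by move=> /(_ [::]) ->.
Qed.

End Kept.
End Phases.

Lemma dgamma_connected (T : finType) (G : sgraph T) (D : decomposition G)
    (j : 'I_(dsize D)) x y : x \in dgamma j -> y \in dgamma j ->
  connect [rel a b | [&& a \in dgamma j, b \in dgamma j & adj G a b]] x y.
Proof.
move=> xj yj; have [H conn _] := dtree_spanning j.
by apply: connect_sub (conn x y xj yj) => a b /H ab; apply: connect1.
Qed.

(** * Correctness of the whole algorithm *)

Section Correctness.
Variables (n : nat) (G : sgraph 'I_n) (f tau : nat) (D : decomposition G).
Let inp := enc_input f D tau.
Let U := dU D.

Lemma peeled_kept lg (Jp : {set 'I_(dsize D)}) (F : {set 'I_n}) : n <= 2 ^ lg ->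
  (forall m a b, m < num_moduli n f lg -> a < num_moduli n f lg ->
     b < num_moduli n f lg -> peeled f tau m a b Jp) -> #|F| <= f ->
  forall j, j \notin Jp -> forall y z,
    y \in touching G (@dgamma _ _ D) U j -> z \in touching G (@dgamma _ _ D) U j ->
    y \notin F -> z \notin F -> connect (kept_rel G (@dgamma _ _ D) U Jp F) y z.
Proof.
move=> nlg H Ff j jJ y z yt zt yF zF.
(* Capping f at n is harmless, as F has at most n elements. *)
have Ff' : #|F| <= cap_f n f.
  by rewrite leq_min Ff -[X in _ <= X](card_ord n) max_card.
(* The class of the residues of y and z modulo m contains y and z but no element of F. *)
have [m [m0 mM good]] := good_modulus yF zF Ff' nlg.
have mM' : m < num_moduli n f lg by [].
have lt_mod k : k %% m < num_moduli n f lg.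
  by apply: leq_trans (ltn_pmod k m0) (ltnW mM').
have [used [uJ done]] := H m (y %% m) (z %% m) mM' (lt_mod y) (lt_mod z).
apply: (levels_connect (@dgamma_disjoint _ _ D) (@dgamma_connected _ G D) Ff' _ _ uJ
          _ jJ (S := side f tau m (y %% m) (z %% m))).
- by move=> i; apply: subsetIl.
- move=> i; apply/pred0P => x /=; apply/negP => /andP[]; rewrite inE => /andP[_].
  rewrite inE => /hasP[q _ /orP[]] /eqP E xF; have [h1 h2] := good x xF.
    by apply: h1; rewrite E modnMDl modn_mod.
  by apply: h2; rewrite E modnMDl modn_mod.
- by move=> k kf; apply: done.
- rewrite inE yt inE; apply/hasP; exists (y %/ m); last by rewrite -divn_eq eqxx.
  by rewrite mem_iota (leq_ltn_trans (leq_div _ _)) // ord_lt_N.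
- rewrite inE zt inE; apply/hasP; exists (z %/ m); last by rewrite -divn_eq eqxx orbT.
  by rewrite mem_iota (leq_ltn_trans (leq_div _ _)) // ord_lt_N.
Qed.

Lemma card_overloaded lg (Jp : {set 'I_(dsize D)}) (load : 'I_n -> nat) :
  #|Jp| <= peel_factor n f lg * #|U| ->
  \sum_x load x <= 2 * (#|U| + #|Jp|) ->
  #|[set x | max_load n f tau lg <= load x]| * tau <= #|U|.
Proof.
move=> JpU tot; set B := [set x | _]; set K := peel_factor n f lg in JpU *.
have BL : #|B| * max_load n f tau lg <= \sum_x load x.
  rewrite -sum_nat_const [leqRHS](bigID (mem B)) /=; apply: leq_trans (leq_addr _ _).
  by apply: leq_sum => x; rewrite inE.
have Bt : #|B| * minn tau n.+1 <= #|U|.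
  have : #|B| * minn tau n.+1 * (2 * K.+1) <= #|U| * (2 * K.+1).
    apply: leq_trans (_ : 2 * (#|U| + #|Jp|) <= _).
      by rewrite -mulnA (leq_trans BL tot).
    have -> : #|U| * (2 * K.+1) = 2 * (#|U| + K * #|U|).
      by rewrite mulnCA mulnS [#|U| * K]mulnC.
    by rewrite leq_mul2l leq_add2l.
  by rewrite leq_pmul2r.
have [tn|nt] := leqP tau n.+1; first by rewrite (minn_idPl tn) in Bt.
(* When tau is capped, |B| (n+1) <= |U| <= n forces B to be empty. *)
rewrite (minn_idPr (ltnW nt)) in Bt.
have Un : #|U| <= n by rewrite -[X in _ <= X](card_ord n) max_card.
case: (#|B|) Bt => [|b]; first by [].
rewrite mulSn => H; have := leq_trans (leq_trans (leq_addr _ _) H) Un.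
by rewrite ltnn.
Qed.

Lemma decomp_correct : exists (D' : decomposition G) (lg : nat),
  [/\ (hrun inp decomp_cmd (fun=> 0) hinit).2 = enc_decomp D',
      forall (F : {set 'I_n}) a b, #|F| <= f -> a \in U -> b \in U -> a \notin F ->
        connect (resp_rel G (@dgamma _ _ D) U F) a b -> triplet_respects D' a b F,
      #|dU D'| * tau <= #|U|,
      decomp_degree D' <= decomp_degree D + max_load n f tau lg
    & n <= 2 ^ lg /\ (lg = 0 \/ 2 ^ lg.-1 < n)].
Proof.
rewrite /decomp_cmd !hrun_seq.
have [lg [B0 M0 nlg lgn]] := log_ok f tau D.
set S0 := hrun _ log_cmd _ _ in B0 M0 *.
have [B1 c1 P1] := peel_ok f tau D B0; set S1 := hrun _ peel_cmd _ _ in B1 c1 P1 *.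
rewrite M0 cards0 add0n in c1.
have F2 := init_ok f tau B1 (erefl (marked D S1)); set S2 := hrun _ init_cmd _ _ in F2 *.
have [[o3 lg3 W3 lab3 FI] cross] := forest_cmd_ok F2.
set S3 := hrun _ forest_cmd _ _ in o3 lg3 W3 lab3 FI cross *.
exists (parts_decomposition FI [set x | max_load n f tau lg <= loads S3 x]), lg.
split=> //.
- exact: emit_ok.
- move=> F a b Ff aU bU aF ab; apply: parts_respects => //.
  + by move=> x y xW yW xy; rewrite !inE; apply: cross.
  + by rewrite inE aU.
  + apply: (resp_kept (@dgamma_disjoint _ _ D)) ab => //.
    exact: peeled_kept nlg P1 Ff.
- apply: card_overloaded c1 _; apply: leq_trans (forest_total FI); exact: leq_addr.
- exact: parts_degree.
Qed.

End Correctness.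

(** * Numerical bounds *)

Lemma max_load_le n f tau lg : 0 < f -> 0 < lg ->
  max_load n f tau lg <= 866 * (tau * (f * lg) ^ 4).
Proof.
move=> f0 lg0; rewrite /max_load.
have q0 : 0 < f * lg by rewrite muln_gt0 f0.
set q := f * lg in q0 *.
have capf : cap_f n f <= f by apply: geq_minl.
have M6 : num_moduli n f lg <= 6 * q.
  have c : cap_f n f * lg <= q by rewrite leq_mul2r capf orbT.
  have := geq_minr n (2 * (cap_f n f * lg) + 2); rewrite /num_moduli; lia.
have f2 : (cap_f n f).+1 <= 2 * q.
  have : f <= q by rewrite leq_pmulr.
  lia.
have K1 : peel_factor n f lg <= 6 * q * (6 * q * (6 * q * (2 * q))).
  by rewrite /peel_factor; do 3!apply: leq_mul => //.
(* Here 432 = 6^3 * 2, and the successor adds at most q^4; doubling 433 gives the constant 866. *)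
have K2 : (peel_factor n f lg).+1 <= 433 * q ^ 4.
  have : 0 < q ^ 4 by rewrite expn_gt0 q0.
  have -> : 433 * q ^ 4 = q ^ 4 + 432 * q ^ 4 by lia.
  have <- : 6 * q * (6 * q * (6 * q * (2 * q))) = 432 * q ^ 4.
    by rewrite !expnS expn0; lia.
  lia.
apply: leq_trans (leq_mul (geq_minl tau n.+1) (leqnn _)) _.
rewrite [leqRHS]mulnCA leq_mul2l; apply/orP; right; lia.
Qed.

(** Treats the case in which ln n leaves no room for an error term. *)
Lemma decomp_degree_le1 n (G : sgraph 'I_n) (D : decomposition G) :
  n <= 1 -> decomp_degree D = 0.
Proof.
move=> n1; apply/eqP; rewrite -leqn0; apply/bigmax_leqP => j _.
apply/bigmax_leqP => x _; rewrite leqn0 cards_eq0; apply/eqP/setP => y.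
rewrite !inE (_ : y = x) ?adj_irr //; apply: val_inj => /=.
by have := ltn_ord x; have := ltn_ord y; lia.
Qed.

Lemma INR_expn m k : INR (m ^ k) = (INR m ^ k)%real.
Proof. by elim: k => [|k IH] //; rewrite expnS mult_INR IH. Qed.

Lemma INR_leq m k : m <= k -> (INR m <= INR k)%real.
Proof. by move=> /leP; apply: le_INR. Qed.

Lemma ln_monotone x y : (0 < x)%real -> (x <= y)%real -> (ln x <= ln y)%real.
Proof. by move=> x0 [xy|->]; [left; apply: ln_increasing|right]. Qed.

(** As ln 2 > 1/2, both lg - 1 and 1 are at most 2 ln n. *)
Lemma log_le_ln n lg : 1 < n -> 2 ^ lg.-1 < n -> 0 < lg ->
  (/ 2 < ln (INR n))%real /\ (INR lg <= 4 * ln (INR n))%real.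
Proof.
move=> n1 lgn lg0.
have l2 := ln_lt_2.
have l2n : (ln 2 <= ln (INR n))%real.
  by apply: ln_monotone; [lra|have := INR_leq n1; rewrite /=; lra].
have l2lg : (INR lg.-1 * ln 2 <= ln (INR n))%real.
  rewrite -ln_pow; last lra.
  apply: ln_monotone; first by apply: pow_lt; lra.
  by have := INR_leq (ltnW lgn); rewrite INR_expn.
have lgE : INR lg = (INR lg.-1 + 1)%real by rewrite -S_INR prednK.
have p0 : (0 <= INR lg.-1)%real := pos_INR _.
split; first lra.
have : (INR lg.-1 * / 2 <= INR lg.-1 * ln 2)%real by apply: Rmult_le_compat_l => //; lra.
by lra.
Qed.

(** With y = f ln n >= 1/2, the fourth power of f lg <= 4 y is raised to y^12 by the factor (2 y)^8
    >= 1. The constant is 866 * 4^4 * 2^8. *)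
Lemma max_load_real n f tau lg : 0 < f -> 1 < n -> n <= 2 ^ lg ->
  (lg = 0 \/ 2 ^ lg.-1 < n) ->
  (INR (max_load n f tau lg) <=
   56754176 * (INR tau * (INR f * ln (INR n)) ^ 12))%real.
Proof.
move=> f0 n1 nlg lgn.
have lg0 : 0 < lg by case: (lg) nlg => //; rewrite expn0 leqNgt n1.
have {}lgn : 2 ^ lg.-1 < n by case: lgn => // lgE; rewrite lgE in lg0.
have [ln2 lgln] := log_le_ln n1 lgn lg0.
have := INR_leq (@max_load_le n f tau lg f0 lg0).
rewrite (mult_INR 866) (mult_INR tau) INR_expn (mult_INR f).
have -> : INR 866 = 866%real by rewrite INR_IZR_INZ.
have f1 : (1 <= INR f)%real := INR_leq f0.
have t0 : (0 <= INR tau)%real := pos_INR _.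
set y := (INR f * ln (INR n))%real; set t := INR tau in t0 *.
have y1 : (1 <= 2 * y)%real.
  have : (1 * / 2 <= y)%real by apply: Rmult_le_compat; lra.
  lra.
have q1 : (INR f * INR lg <= 4 * y)%real.
  have : (INR f * INR lg <= INR f * (4 * ln (INR n)))%real.
    by apply: Rmult_le_compat_l => //; lra.
  rewrite /y; lra.
have q0 : (0 <= INR f * INR lg)%real by apply: Rmult_le_pos; apply: pos_INR.
have q4 : ((INR f * INR lg) ^ 4 <= (4 * y) ^ 4)%real by apply: pow_incr.
have y8 : (1 <= (2 * y) ^ 8)%real by apply: pow_R1_Rle.
have y4 : ((4 * y) ^ 4 <= 65536 * y ^ 12)%real.
  have -> : (65536 * y ^ 12 = (4 * y) ^ 4 * (2 * y) ^ 8)%real by ring.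
  rewrite -[X in (X <= _)%real]Rmult_1_r.
  by apply: Rmult_le_compat_l => //; apply: pow_le; lra.
have : (t * (INR f * INR lg) ^ 4 <= t * (65536 * y ^ 12))%real.
  by apply: Rmult_le_compat_l => //; lra.
by lra.
Qed.

Lemma size_le_bit_size inp : size inp <= bit_size inp.
Proof.
rewrite -(sum1_size inp) /bit_size; by apply: leq_sum.
Qed.

Lemma wf_decomp_cmd : wf_cmd decomp_cmd.
Proof. by vm_compute. Qed.

Theorem theoremB3 :
  exists (prog : cmd) (c d : nat) (C : R),
  forall (n : nat) (G : sgraph 'I_n) (f : nat) (D : decomposition G) (tau : nat),
    1 <= f -> 2 <= tau ->
    exists D' : decomposition G,
      [/\ exists time : nat,
            computes prog (enc_input f D tau) time (enc_decomp D') /\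
            time <= c * (bit_size (enc_input f D tau)) ^ d,
          forall Q : {set 'I_n * 'I_n * {set 'I_n}}, respecting f D Q ->
            exists Q' : {set 'I_n * 'I_n * {set 'I_n}},
              respecting f D' Q' /\
              (forall (s t : 'I_n) (F : {set 'I_n}),
                 (s, t, F) \in Q -> ~ captured D s t F ->
                 forall a b : 'I_n, a \in Uset D s F -> b \in Uset D t F ->
                   (a, b, F) \in Q'),
          (INR #|dU D'| <= INR #|dU D| / INR tau)%real
        & (INR (decomp_degree D') <=
             INR (decomp_degree D) + C * (INR tau * (INR f * ln (INR n)) ^ 12))%real].
Proof.
have [prog [c [d progP]]] := compile_correct wf_decomp_cmd.
(* The compiler bounds the time in terms of the input length plus one, which is at most twice the
   bit size because the input is nonempty; hence the factor 2^d. *)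
exists prog, (c * 2 ^ d), d, 56754176%real => n G f D tau f1 tau2.
have [D' [lg [out resp small deg [nlg lgn]]]] := decomp_correct f tau D.
exists D'; split.
- have [time run time_le] := progP (enc_input f D tau).
  exists time; split; first by rewrite -out.
  apply: leq_trans time_le _; rewrite -mulnA -expnMn leq_mul2l; apply/orP; right.
  have : (size (enc_input f D tau)).+1 <= 2 * bit_size (enc_input f D tau).
    by have := size_le_bit_size (enc_input f D tau); rewrite [size _]/=; lia.
  by case: (d) => [|d'] H; rewrite ?expn0 // leq_exp2r.
- move=> Q RQ; have [Q' [RQ' HQ']] := respecting_transfer resp RQ.
  by exists Q'; split=> // s t F stF _ a b; apply: HQ'.
- have t0 : (0 < INR tau)%real by apply: lt_0_INR; apply/ltP; apply: ltnW.
  apply: (Rmult_le_reg_r (INR tau)) => //.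
  rewrite /Rdiv Rmult_assoc Rinv_l ?Rmult_1_r; last lra.
  by rewrite -mult_INR; apply: INR_leq.
- have [n1|n1] := leqP n 1.
    rewrite (decomp_degree_le1 D' n1).
    have := pos_INR (decomp_degree D).
    have : (0 <= INR tau * (INR f * ln (INR n)) ^ 12)%real.
      apply: Rmult_le_pos; first exact: pos_INR.
      (* The exponent is even, so the error term is nonnegative whatever value [ln] takes, including
         at n = 0. *)
      have -> : ((INR f * ln (INR n)) ^ 12 = Rsqr ((INR f * ln (INR n)) ^ 6))%real.
        by rewrite /Rsqr; ring.
      exact: Rle_0_sqr.
    rewrite [INR 0]/=; lra.
  have := INR_leq deg; rewrite plus_INR.
  have := max_load_real tau f1 n1 nlg lgn; lra.
Qed.
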